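(* Let $a<b$ be real and $c=(a+b)/2$. Let $\beta_1=2$ and $\alpha_1=(b-a)/4$. Amongst all monic quadratic polynomials $\phi$ with real coefficients, $\phi(x)=(x-c)^2-\alpha_1^2$ is the unique minimizer of the optimal error constant $K_\infty(\phi)$ (defined in the context). This choice gives, for every $f:[a,b]\to\mathbb{R}$ such that $f'$ is absolutely continuous on $[a,b]$ and $f''\in L^\infty([a,b])$, the quadrature formula $$\int_a^b f(x)\,dx=\frac{b-a}{2}\left[f(a)+f(b)\right]+\frac{3(b-a)^2}{32}\left[f'(a)-f'(b)\right]+E(f),$$ where $|E(f)|\le \|f''\|_\infty(b-a)^{3}/32$, and this error estimate is optimal: the coefficient $(b-a)^{3}/32$ of $\|f''\|_\infty$ cannot be replaced by any smaller constant valid for all such $f$.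
   Context: $\|\cdot\|_\infty$ is the $L^\infty([a,b])$ norm. For a monic quadratic polynomial $\phi$ with real coefficients and $f$ with $f'$ absolutely continuous on $[a,b]$, define $E_\phi(f)$ by $$\int_a^b f(x)\,dx=\tfrac12\left[-f(a)\phi'(a)+f(b)\phi'(b)+f'(a)\phi(a)-f'(b)\phi(b)\right]+E_\phi(f);$$ integration by parts gives $E_\phi(f)=\tfrac12\int_a^b f''(x)\phi(x)\,dx$. The optimal error constant is $$K_\infty(\phi)=\sup\{|E_\phi(f)| : f' \text{ absolutely continuous on } [a,b],\ f''\in L^\infty([a,b]),\ \|f''\|_\infty\le 1\}.$$ In the quadrature formula, $E(f)=E_\phi(f)$ for the stated $\phi$. *)

(* Defs.v *)
From HB Require Import structures.
From mathcomp Require Import all_boot all_order all_algebra.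
From mathcomp Require Import all_classical all_reals all_analysis.

Set Implicit Arguments.
Unset Strict Implicit.
Unset Printing Implicit Defensive.

Import Order.TTheory GRing.Theory Num.Theory.
Import numFieldNormedType.Exports.

Local Open Scope classical_set_scope.
Local Open Scope ring_scope.

(* A function on [a, b] is represented by a total function R -> R; everything
   below only looks at its values on [a, b].  Derivatives are therefore taken
   relative to [a, b]: two-sided at interior points, one-sided at a and b. *)
Definition derivable_cc (R : realType) (a b : R) (f : R -> R) (x : R) : Prop :=
  cvg ((f y - f x) / (y - x) @[y --> within `[a, b] x^']).

Definition derive_cc (R : realType) (a b : R) (f : R -> R) (x : R) : R :=
  lim ((f y - f x) / (y - x) @[y --> within `[a, b] x^']).

Lemma derive_ccE (R : realType) (a b : R) (f : R -> R) x : x \in `]a, b[ ->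
  derive_cc a b f x = derive1 f x /\ (derivable_cc a b f x <-> derivable f x 1).
Proof.
move=> xab.
have W : within `[a, b] x^' = x^'.
  rewrite eqEsubset; split=> P /= H; last first.
    by rewrite /within/=; near=> y => ?; near: y.
  have N : \forall y \near x^', `[a, b]%classic y.
    have HH : \forall y \near x, `[a, b]%classic y.
      near=> y; apply: subset_itv_oo_cc; near: y; exact: near_in_itvoo.
    exact: nbhs_dnbhs HH.
  rewrite /within/= in H.
  by apply: filterS2 H N => y; apply.
have S : (f y - f x) / (y - x) @[y --> x^'] =
   (h^-1 *: (f (h + x) - f x) @[h --> 0^']).
  have -> : x^' = (h + x) @[h --> 0^'].
    rewrite eqEsubset; split => P /=.
    - move=> /nbhs_ballP[e /= e0 He]; apply/nbhs_ballP; exists e => //= h.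
      rewrite /ball/= sub0r normrN => he h0; apply: He => /=.
        by rewrite /ball /= opprD addrCA subrr addr0 normrN.
      by rewrite -subr_eq0 addrK.
    - move=> /nbhs_ballP[e /= e0 He]; apply/nbhs_ballP; exists e => //= h.
      rewrite /ball/= => he h0; have := He (h - x); rewrite /= subrK; apply.
        by rewrite /ball/= sub0r normrN distrC.
      by rewrite subr_eq0.
  rewrite eqEsubset; split => P /=; rewrite /nbhs/= => H; apply: filterS H => h /=;
    by rewrite addrK mulrC.
rewrite /derive_cc /derive1 /derivable_cc W S; split => //.
rewrite /derivable.
have -> : (fun h : R => h^-1 *: ((f \o shift x) (h *: (1:R)) - f x)) = (fun h => h^-1 *: (f (h + x) - f x)).
  by apply/funext => h /=; rewrite /GRing.scale/= mulr1.
by [].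
Unshelve. all: end_near.
Qed.

Definition abs_continuous (R : realType) (a b : R) (g : R -> R) : Prop :=
  forall e : R, 0 < e -> exists2 d : R, 0 < d &
    forall (n : nat) (x y : 'I_n -> R),
      (forall i, [/\ a <= x i, x i <= y i & y i <= b]) ->
      trivIset [set: 'I_n] (fun i => `]x i, y i[%classic) ->
      \sum_(i < n) (y i - x i) < d ->
      \sum_(i < n) `|g (y i) - g (x i)| < e.

(* L^oo([a, b]) and its norm, through extension by 0 outside [a, b] *)
Definition Loo_cc (R : realType) (a b : R) (h : R -> R) : Prop :=
  h \_ `[a, b] \in Lfun (@lebesgue_measure R) +oo%E.

Definition Loo_norm_cc (R : realType) (a b : R) (h : R -> R) : \bar R :=
  'N[@lebesgue_measure R]_+oo%E[EFin \o h \_ `[a, b]].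

(* f'' may fail to exist on a null set, where [derive_cc] returns a default
   value; by absolute continuity of f' this does not affect the class of f''. *)
Definition admissible (R : realType) (a b : R) : set (R -> R) :=
  [set f | [/\ forall x, x \in `[a, b] -> derivable_cc a b f x,
               abs_continuous a b (derive_cc a b f)
             & Loo_cc a b (derive_cc a b (derive_cc a b f))] ].

Definition monic_quadratic (R : realType) : set {poly R} :=
  [set phi | phi \is monic /\ size phi = 3%N].

Definition quad_error (R : realType) (a b : R) (phi : {poly R})
    (f : R -> R) : R :=
  \int[@lebesgue_measure R]_(x in `[a, b]) f x
  - 2^-1 * (- f a * phi^`().[a] + f b * phi^`().[b]
            + derive_cc a b f a * phi.[a] - derive_cc a b f b * phi.[b]).

Definition Koo (R : realType) (a b : R) (phi : {poly R}) : \bar R :=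
  ereal_sup [set `|quad_error a b phi f|%:E | f in
    [set f | admissible a b f /\
       (Loo_norm_cc a b (derive_cc a b (derive_cc a b f)) <= 1)%E] ].

(* Main.v *)
(* Write [al = (b - a) / 4] and [c = (a + b) / 2].  Lower bound: the spline whose
   second derivative is 1, -1, 1 with breaks at [t < u] satisfies, for every monic
   quadratic [psi] with primitive [Psi],
     E_psi = (Psi b - Psi a) / 2 + Psi t - Psi u,
   and for [t, u = c - al, c + al] this is (b - a)^3 / 32 whatever [psi] is.  If
   the supremum does not exceed this value, then [(t, u)] is an interior maximum,
   so [psi] vanishes at [c - al] and [c + al], which determines it.
   Upper bound: if [g = f'] is [M]-Lipschitz, then
     2 E = [g phi]_a^b - (integral of g phi'),
   and comparing [g] with suitable lines bounds it by [4 M al^3].  That [f'] is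
   Lipschitz needs that absolutely continuous functions are differentiable almost
   everywhere: Lipschitz functions are, by Radon-Nikodym and Lebesgue
   differentiation; by a Vitali covering argument, almost every point [x] of an
   absolutely continuous [G] has a finite bound on |G y - G x| / |y - x|; and on
   the set of points where this bound is [n], [G] is pinched between two
   [n]-Lipschitz functions (Stepanov). *)

Require Import Defs.
From HB Require Import structures.
From mathcomp Require Import all_boot all_order all_algebra.
From mathcomp Require Import all_classical all_reals all_analysis.
From mathcomp Require Import measurable_realfun.
From mathcomp Require Import ring lra.
Import Order.TTheory GRing.Theory Num.Theory.
Import numFieldNormedType.Exports.
Local Open Scope classical_set_scope.
Local Open Scope ring_scope.

Set Implicit Arguments.
Unset Strict Implicit.

(** * Almost everywhere differentiability of Lipschitz functions *)

Lemma lipschitz_continuous (R : realType) (n : R) (f : R -> R) :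
  (forall x y, `|f x - f y| <= n * `|x - y|) -> continuous f.
Proof.
move=> fL x; apply/cvgrPdist_lt => e e0.
have n1 : 0 < `|n| + 1 by rewrite ltr_wpDl.
near=> y; apply: le_lt_trans (fL x y) _.
apply: (@le_lt_trans _ _ ((`|n| + 1) * `|x - y|)).
  by rewrite ler_wpM2r// (le_trans (ler_norm n))// lerDl.
rewrite -ltr_pdivlMl//; near: y.
by apply: (@cvgr_dist_lt _ R^o _ _ _ id x) => //; rewrite mulr_gt0// invr_gt0.
Unshelve. all: end_near. Qed.

Lemma ae_mono (R : realType) (P Q : R -> Prop) : (forall x, P x -> Q x) ->
  {ae (@lebesgue_measure R), forall x, P x} ->
  {ae (@lebesgue_measure R), forall x, Q x}.
Proof.
by move=> PQ; apply: filterS PQ; exact: (ae_filter_ringOfSetsType lebesgue_measure).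
Qed.

Lemma ae_and (R : realType) (P Q : R -> Prop) :
  {ae (@lebesgue_measure R), forall x, P x} ->
  {ae (@lebesgue_measure R), forall x, Q x} ->
  {ae (@lebesgue_measure R), forall x, P x /\ Q x}.
Proof.
have F := ae_filter_ringOfSetsType (@lebesgue_measure R).
exact: filterI.
Qed.

Lemma stieltjes_measure_ocitv (R : realType) (f : cumulative R R) (x y : R) :
  x <= y -> lebesgue_stieltjes_measure f `]x, y] = (f y - f x)%:E.
Proof.
move=> xy; rewrite /lebesgue_stieltjes_measure/= /measure_extension/=.
by rewrite measurable_mu_extE/= ?wlength_itv_bnd//; exact: is_ocitv.
Qed.

(** The Stieltjes measures of [f] and [g] add up to Lebesgue measure, since they do so on half-open
    intervals; a Lebesgue null set is therefore null for each summand. *)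
Lemma stieltjes_dominated (R : realType) (f g : cumulative R R) :
  (forall x, f x + g x = x) ->
  lebesgue_stieltjes_measure f `<< (@lebesgue_measure R).
Proof.
move=> fg; apply/null_content_dominatesP => A mA A0.
pose nu :=
  measure_add (lebesgue_stieltjes_measure f) (lebesgue_stieltjes_measure g).
have nuE B : nu B = (lebesgue_stieltjes_measure f B + lebesgue_stieltjes_measure g B)%E.
  exact: measure_addE.
have : lebesgue_measure A = nu A.
  apply: lebesgue_measure_unique => // _ [[x y] _ <-].
  apply: eq_trans (esym (nuE _)); rewrite /=.
  have [xy|yx] := leP x y; last first.
    rewrite (_ : `]x, y]%classic = set0) ?measure0 ?adde0//.
    by apply: set_itv_ge; rewrite bnd_simp -leNgt ltW.
  rewrite !stieltjes_measure_ocitv// -EFinD.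
  rewrite lebesgue_measure_itv/= lte_fin; have [_|yx] := ltP x y.
    by rewrite -EFinD; congr EFin; have := fg x; have := fg y; lra.
  by have -> : x = y; [lra|congr EFin; lra].
rewrite A0 nuE => /esym/eqP.
by rewrite padde_eq0// => /andP[/eqP].
Qed.

(** By Radon-Nikodym the measure of [f] has a density, so [f] is locally an indefinite integral,
    which Lebesgue differentiation handles. *)
Lemma cumulative_ae_derivable (R : realType) (f g : cumulative R R) (u v : R) :
  (forall x, f x + g x = x) ->
  {ae (@lebesgue_measure R), forall x, x \in `]u, v[ -> derivable f x 1}.
Proof.
move=> fg; have [uv|] := ltP u v; last first.
  move=> vu; apply: aeW => x; rewrite in_itv/= => /andP[ux xv].
  by have := lt_trans ux xv; rewrite ltNge vu.
have fin : (lebesgue_stieltjes_measure f `]u, v] < +oo)%E.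
  by rewrite stieltjes_measure_ocitv ?ltry// ltW.
(* Restricting the measure to []u, v]] makes it finite, so its density is integrable over the whole
   line. *)
pose nu : {finite_measure set (measurableTypeR R) -> \bar R} :=
  @mfrestr _ (measurableTypeR R) R _ (lebesgue_stieltjes_measure f)
    (measurable_itv `]u, v]) fin.
have numu : nu `<< (@lebesgue_measure R).
  apply/null_content_dominatesP => A mA A0.
  have /null_content_dominatesP := @stieltjes_dominated R f g fg.
  apply; first exact: measurableI.
  apply/eqP; rewrite -measure_le0 -A0 le_measure// inE//.
  exact: measurableI.
have [h [h0 hfin inth nuE]] := 
  @radon_nikodym_sigma_finite _ (measurableTypeR R) R (@lebesgue_measure R) nu numu.
have hE : EFin \o (fine \o h) = h by apply/funext => x /=; rewrite fineK.
have int1 : (@lebesgue_measure R).-integrable setT (EFin \o (fine \o h)) by rewrite hE.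
have := @FTC1 R (fine \o h) (BRight u).
have int2 y : (@lebesgue_measure R).-integrable `]u, y] (EFin \o (fine \o h)).
  exact: integrableS int1.
move=> /(_ int2).
move=> /(_ (open_integrable_locally openT int1)).
apply: ae_mono => x + /[!in_itv]/= /andP[ux xv].
move=> /(_ ux)[dx _].
(* [F] is [f] rebuilt from its density; the two agree near every point of []u, v[]. *)
pose F y := f u + \int[lebesgue_measure]_(t in `]u, y]) (fine \o h) t.
have dF : derivable F x 1 by exact: (derivableD (derivable_cst _ _ _) dx).
apply: (near_eq_derivable _ dF).
near=> y.
have uy : u < y by near: y; exact: lt_nbhsr.
have yv : y < v by near: y; exact: lt_nbhsl.
have -> : F y = f u + fine (nu `]u, y]%classic).
  rewrite nuE//; congr (_ + fine _).
  by apply: eq_integral => t _ /=; rewrite fineK.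
rewrite /nu /= /mfrestr /mrestr.
rewrite (_ : _ `&` _ = `]u, y]%classic); last first.
  apply/seteqP; split => z/=; rewrite !in_itv/=; first by case.
  by move=> /andP[-> zy]; split => //; rewrite (le_trans zy) ?ltW.
by rewrite stieltjes_measure_ocitv ?(ltW uy)//= addrC subrK.
Unshelve. all: end_near. Qed.

Lemma eq_derivable (R : realType) (f g : R -> R) (x : R) :
  f =1 g -> derivable f x 1 -> derivable g x 1.
Proof. by move=> /funext ->. Qed.

(** The functions [(x + f x) / 2] and [(x - f x) / 2] are nondecreasing with sum [x], and [f] is
    twice the first minus the identity. *)
Lemma lipschitz1_ae_derivable (R : realType) (f : R -> R) (u v : R) :
  (forall x y, `|f x - f y| <= `|x - y|) ->
  {ae (@lebesgue_measure R), forall x, x \in `]u, v[ -> derivable f x 1}.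
Proof.
move=> fL.
have cf : continuous f by apply: (@lipschitz_continuous R 1) => x y; rewrite mul1r.
pose F (s : R) x := (x + s * f x) / 2.
have ndF (s : R) : `|s| = 1 -> nondecreasing (F s).
  move=> s1 x y xy; have := fL y x.
  have -> : `|f y - f x| = `|s * (f y - f x)| by rewrite normrM s1 mul1r.
  rewrite (ger0_norm (_ : 0 <= y - x)) ?subr_ge0// ler_norml => /andP[+ _].
  by rewrite /F; lra.
have rcF s : right_continuous (F s).
  apply/right_continuousW => x; apply: cvgM; last exact: cvg_cst.
  by apply: cvgD; [exact: cvg_id|apply: cvgM; [exact: cvg_cst|exact: cf]].
pose C1 := isCumulative.Build R _ R (F 1) (ndF 1 (normr1 _)) (rcF 1).
pose F1 : cumulative R R := HB.pack (F 1) C1.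
pose C2 := isCumulative.Build R _ R (F (-1)) (ndF (-1) (normrN1 _)) (rcF (-1)).
pose F2 : cumulative R R := HB.pack (F (-1)) C2.
have := @cumulative_ae_derivable R F1 F2 u v.
have FF x : F1 x + F2 x = x by rewrite /F1 /F2/= /F; lra.
move=> /(_ FF); apply: ae_mono => x + xuv => /(_ xuv); rewrite -/(F 1) => d1.
have := derivableB (@derivableZ R R R (F 1) 2 x 1 d1) (@derivable_id R R x 1).
apply: eq_derivable => y.
by change (2 * ((y + 1 * f y) / 2) - y = f y); lra.
Qed.

Lemma lipschitz_ae_derivable (R : realType) (n : R) (f : R -> R) (u v : R) :
  0 < n -> (forall x y, `|f x - f y| <= n * `|x - y|) ->
  {ae (@lebesgue_measure R), forall x, x \in `]u, v[ -> derivable f x 1}.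
Proof.
move=> n0 fL.
have : {ae (@lebesgue_measure R), forall x,
    x \in `]u, v[ -> derivable (n^-1 \*: f) x 1}.
  apply: lipschitz1_ae_derivable => x y /=.
  by rewrite -mulrBr normrM ger0_norm ?invr_ge0 ?(ltW n0)// ler_pdivrMl.
apply: ae_mono => x + xuv => /(_ xuv) d1.
have -> : f = n \*: (n^-1 \*: f).
  by apply/funext => y /=; rewrite scalerA divff ?gt_eqF// scale1r.
exact: derivableZ.
Qed.

(** * Variation over disjoint intervals, and steep points *)

(** The epsilon-delta condition of absolute continuity on the whole line. Families are indexed by
    duplicate-free sequences over any [eqType], the form in which covering arguments produce
    them. *)
Definition small_variation (R : realType) (G : R -> R) (d e : R) : Prop :=
  forall (I : eqType) (s : seq I) (X Y : I -> R), uniq s ->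
    (forall i, i \in s -> X i <= Y i) ->
    trivIset [set` s] (fun i => `]X i, Y i[%classic) ->
    \sum_(i <- s) (Y i - X i) < d ->
    \sum_(i <- s) `|G (Y i) - G (X i)| < e.

Definition variation_lt (R : realType) (G : R -> R) (e : R) : Prop :=
  forall (I : eqType) (s : seq I) (X Y : I -> R), uniq s ->
    (forall i, i \in s -> X i <= Y i) ->
    trivIset [set` s] (fun i => `]X i, Y i[%classic) ->
    \sum_(i <- s) `|G (Y i) - G (X i)| < e.

(** Precomposition with [clamp u v] extends a function on [[u, v]] to the line by its end values. *)
Definition clamp (R : realType) (u v x : R) : R := Num.max u (Num.min x v).

Lemma clamp_itv (R : realType) (u v x : R) : u <= v -> u <= clamp u v x <= v.
Proof.
by move=> uv; rewrite /clamp /Num.max /Num.min; case: ifP; case: ifP; lra.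
Qed.

Lemma clamp_id (R : realType) (u v x : R) : u <= x <= v -> clamp u v x = x.
Proof. by rewrite /clamp /Num.max /Num.min; case: ifP; case: ifP; lra. Qed.

Lemma clamp_le (R : realType) (u v x y : R) : x <= y ->
  clamp u v x <= clamp u v y.
Proof. by rewrite /clamp /Num.max /Num.min; do !case: ifP; lra. Qed.

Lemma clampB_le (R : realType) (u v x y : R) : x <= y ->
  clamp u v y - clamp u v x <= y - x.
Proof. by rewrite /clamp /Num.max /Num.min; do !case: ifP; lra. Qed.

Lemma clamp_itvoo (R : realType) (u v x y : R) :
  `]clamp u v x, clamp u v y[%classic `<=` `]x, y[%classic.
Proof.
move=> z /=; rewrite !in_itv/= /clamp /Num.max /Num.min.
by do !case: ifP; lra.
Qed.

Lemma trivIset_sub (T I : Type) (D : set I) (F G : I -> set T) :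
  (forall i, F i `<=` G i) -> trivIset D G -> trivIset D F.
Proof.
move=> FG tG i j Di Dj [x [Fx Gx]]; apply: tG => //.
by exists x; split; exact: FG.
Qed.

Lemma trivIset_tnth (T : Type) (I : eqType) (s : seq I) (F : I -> set T) :
  uniq s -> trivIset [set` s] F ->
  trivIset [set: 'I_(size s)] (fun k => F (tnth (in_tuple s) k)).
Proof.
move=> us tF k l _ _ /tF /= kl.
have /tuple_uniqP := us : uniq (in_tuple s); apply.
by apply: kl; exact: mem_tnth.
Qed.

Lemma sum_disjoint_itv_le (R : realType) (I : eqType) (s : seq I)
    (X Y : I -> R) (U : set R) : measurable U -> uniq s ->
  (forall i, i \in s -> X i <= Y i) ->
  trivIset [set` s] (fun i => `]X i, Y i[%classic) ->
  (forall i, i \in s -> `]X i, Y i[%classic `<=` U) ->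
  ((\sum_(i <- s) (Y i - X i))%:E <= @lebesgue_measure R U)%E.
Proof.
move=> mU us XY tXY XYU.
pose F (k : 'I_(size s)) : set (measurableTypeR R) :=
  `]X (tnth (in_tuple s) k), Y (tnth (in_tuple s) k)[%classic.
have mF k : measurable (F k) by exact: measurable_itv.
have -> : (\sum_(i <- s) (Y i - X i))%:E = (\sum_(k < size s) lebesgue_measure (F k))%E.
  rewrite big_tnth -sumEFin; apply: eq_bigr => k _.
  have := XY _ (mem_tnth k (in_tuple s)).
  rewrite /F lebesgue_measure_itv/= lte_fin le_eqVlt => /predU1P[->|->].
    by rewrite ltxx subrr.
  by rewrite EFinB.
rewrite -(@measure_bigsetU_ord _ _ _ lebesgue_measure _ predT F mF); last first.
  exact: (trivIset_tnth us tXY).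
apply: le_measure; rewrite ?inE//; first exact: bigsetU_measurable.
apply: (big_ind (fun B => B `<=` U)) => [//|B C BU CU|k _].
  by rewrite subUset.
by apply: XYU; exact: mem_tnth.
Qed.

Lemma le_measure_cover (R : realType) (I : eqType) (s : seq I)
    (F : I -> set R) (A : set R) :
  (forall i, measurable (F i)) -> measurable A -> A `<=` cover [set` s] F ->
  (@lebesgue_measure R A <= \sum_(i <- s) @lebesgue_measure R (F i))%E.
Proof.
move=> mF; elim: s A => [|i s IH] A mA AF.
  rewrite big_nil (_ : A = set0) ?measure0//.
  by apply/seteqP; split => // x /AF[].
rewrite big_cons.
have mAF : measurable (A `\` F i) by apply: measurableD.
apply: (@le_trans _ _ (lebesgue_measure (F i) + lebesgue_measure (A `\` F i))%E).
  have U2 := @measureU2 _ (measurableTypeR R) R lebesgue_measure _ _ (mF i) mAF.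
  apply: (le_trans _ U2).
  apply: le_measure; rewrite ?inE; [exact: mA|exact: (measurableU _ _ (mF i) mAF)|].
  by move=> x Ax; have [|] := pselect (F i x); [left|right].
apply: leeD => //; apply: IH => // x [/AF[j /=]].
by rewrite inE => /predU1P[->//|js] Fjx _; exists j.
Qed.

(** Clamping is monotone and shrinks intervals, so it sends a disjoint family to one in [[a, b]]
    that is still disjoint and no longer in total. The same [d] serves all [u] and [v]. *)
Lemma small_variation_clamp (R : realType) (a b : R) (g : R -> R) (e : R) :
  abs_continuous a b g -> 0 < e ->
  exists2 d, 0 < d & forall u v, a <= u -> u <= v -> v <= b ->
    small_variation (g \o clamp u v) d e.
Proof.
move=> acg e0; have [d d0 dP] := acg e e0.
exists d => // u v au uv vb I s X Y us XY tXY sd.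
rewrite big_tnth; apply: dP => [i||].
- have := XY _ (mem_tnth i (in_tuple s)) => /(clamp_le u v) ->.
  have := clamp_itv (X (tnth (in_tuple s) i)) uv.
  by have := clamp_itv (Y (tnth (in_tuple s) i)) uv; split => //; lra.
- by have := trivIset_tnth us tXY; apply: trivIset_sub => i; exact: clamp_itvoo.
- apply: le_lt_trans sd; rewrite [leRHS]big_tnth; apply: ler_sum => i _.
  by apply: clampB_le; apply: XY; exact: mem_tnth.
Qed.

(** Clamping all endpoints changes no increment and puts the disjoint intervals inside [[u, v]],
    where their total length is at most [v - u]. *)
Lemma variation_clamp (R : realType) (u v : R) (g : R -> R) (d e : R) :
  small_variation (g \o clamp u v) d e -> u <= v -> v - u < d ->
  variation_lt (g \o clamp u v) e.
Proof.
move=> gP uv uvd I s X Y us XY tXY.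
have clK x : clamp u v (clamp u v x) = clamp u v x.
  by apply: clamp_id; exact: clamp_itv.
have tcl : trivIset [set` s]
    (fun i => `](clamp u v \o X) i, (clamp u v \o Y) i[%classic).
  by apply: trivIset_sub tXY => i; exact: clamp_itvoo.
have clXY i : i \in s -> clamp u v (X i) <= clamp u v (Y i).
  by move=> /XY; exact: clamp_le.
apply: le_lt_trans (gP I s _ _ us clXY tcl _).
  by apply: ler_sum => i _ /=; rewrite !clK.
rewrite -lte_fin; apply: (@le_lt_trans _ _ (@lebesgue_measure R `[u, v]%classic)).
  apply: sum_disjoint_itv_le => // i _ z.
  rewrite /= !in_itv/= => /andP[]; have := clamp_itv (X i) uv.
  by have := clamp_itv (Y i) uv; lra.
rewrite lebesgue_measure_itv/= lte_fin -EFinD.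
by case: ifP => _; rewrite ?lte_fin//; lra.
Qed.

(* Vitali's covering lemma extracts from the pairs [x], [y x] disjoint intervals
   whose threefold dilations cover [K]; their total length is at most [1 / c]. *)
Lemma compact_steep_le (R : realType) (G : R -> R) (c : R) (K : set R) :
  variation_lt G 1 -> 0 < c -> compact K ->
  (forall x, K x -> exists y, c * `|y - x| < `|G y - G x|) ->
  (@lebesgue_measure R K <= (6 / c)%:E)%E.
Proof.
move=> varG c0 cK HK.
have mK : measurable K by exact: compact_measurable.
(* Off [K] any [y] other than [x] serves; it makes every radius [r x] positive. *)
have /choice[y yP] : forall x, exists y,
    y != x /\ (K x -> c * `|y - x| < `|G y - G x|).
  move=> x; have [Kx|nKx] := pselect (K x); last first.
    by exists (x + 1); split => //; rewrite -subr_eq0 addrAC subrr add0r oner_neq0.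
  have [z zP] := HK x Kx; exists z; split => //.
  by apply/eqP => zx; move: zP; rewrite zx !subrr !normr0 mulr0 ltxx.
pose r x := `|y x - x|.
have r0 x : 0 < r x by rewrite /r normr_gt0 subr_eq0; have [] := yP x.
pose B x := ball x (r x).
have [D DK KD] : finite_subset_cover K B K.
  move: (cK); rewrite compact_cover; apply; first by move=> i _; exact: ball_open.
  by move=> x Kx; exists x => //; exact: ballxx.
have [E [uE ED tE DE]] := @vitali_lemma_finite_cover R R B
  (fun i => is_ball_ball _ _) (fun i => ex_intro _ i (ballxx i (r0 i)))
  (finmap.enum_fset D).
have KE : K `<=` cover [set` E] (fun i => ball i (3 * r i)).
  move=> x /KD[i /= iD Bix].
  have [|j jE] := DE x; first by exists i.
  rewrite /= scale_ballE//; by exists j.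
have EK i : i \in E -> K i by move=> /ED /DK; rewrite inE.
(* The interval between [i] and [y i] lies in the ball [B i], so these intervals inherit
   disjointness from the balls. *)
pose X i := Num.min i (y i); pose Y i := Num.max i (y i).
have XY i : X i <= Y i by rewrite /X /Y /Num.min /Num.max; case: ifP; lra.
have tXY : trivIset [set` E] (fun i => `]X i, Y i[%classic).
  apply: trivIset_sub tE => i z; rewrite /B ball_itv/= !in_itv/= /X /Y /r.
  rewrite /Num.min /Num.max; case: ifP => h /andP[h1 h2].
    by rewrite ger0_norm ?subr_ge0; lra.
  by rewrite ler0_norm ?subr_le0; lra.
have := varG _ _ _ _ uE (fun i _ => XY i) tXY.
have GE i : `|G (Y i) - G (X i)| = `|G (y i) - G i|.
  by rewrite /X /Y /Num.min /Num.max; case: ifP => _ //; rewrite distrC.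
under eq_bigr do rewrite GE.
have : c * (\sum_(i <- E) r i) <= \sum_(i <- E) `|G (y i) - G i|.
  rewrite mulr_sumr big_seq [leRHS]big_seq; apply: ler_sum => i /EK Ki.
  by have [_ /(_ Ki) /ltW] := yP i.
move=> /le_lt_trans /[apply] cr1.
apply: (le_trans (@le_measure_cover R R E _ K (fun i => measurable_ball _ _) mK KE)).
rewrite (eq_bigr (fun i => (6 * r i)%:E)); last first.
  move=> i _; rewrite [LHS]lebesgue_measure_ball; last by rewrite mulr_ge0// ltW.
  by congr EFin; lra.
rewrite sumEFin lee_fin -mulr_sumr ler_pdivlMr//; nra.
Qed.

Definition steep_points {R : realType} (G : R -> R) (n : nat) : set R :=
  [set x | exists y, n.+1%:R * `|y - x| < `|G y - G x|].

Lemma open_steep_points (R : realType) (G : R -> R) n :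
  continuous G -> open (steep_points G n).
Proof.
move=> cG.
have -> : steep_points G n = \bigcup_y [set x | n.+1%:R * `|y - x| < `|G y - G x|].
  by apply/seteqP; split => [x [y ?]|x [y _ ?]]; exists y.
apply: bigcup_open => y _.
pose h x := `|G y - G x| - n.+1%:R * `|y - x|.
have -> : [set x | n.+1%:R * `|y - x| < `|G y - G x|] = h @^-1` [set z | 0 < z].
  by apply/seteqP; split => x /=; rewrite /h subr_gt0.
apply: open_comp; last exact: open_gt.
move=> x _; apply: cvgB.
  by apply: cvg_norm; apply: cvgB; [exact: cvg_cst|exact: cG].
apply: cvgM; first exact: cvg_cst.
by apply: cvg_norm; apply: cvgB; [exact: cvg_cst|exact: cvg_id].
Qed.

(** A compact subset consists of points steep for every [n], so its measure is at most [6 / n.+1]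
    for all [n], hence zero; inner regularity passes this on to the whole set. *)
Lemma steep_points_null (R : realType) (G : R -> R) (u v : R) :
  continuous G -> variation_lt G 1 ->
  @lebesgue_measure R (`[u, v]%classic `&` \bigcap_n steep_points G n) = 0.
Proof.
move=> cG varG.
set S := (X in lebesgue_measure X).
have mS : measurable S.
  apply: measurableI => //; apply: bigcapT_measurable => n.
  by apply: open_measurable; exact: open_steep_points.
have finS : (@lebesgue_measure R S < +oo)%E.
  apply: (@le_lt_trans _ _ (@lebesgue_measure R `[u, v]%classic)).
    by apply: le_measure; rewrite ?inE//; exact: subIsetl.
  by rewrite lebesgue_measure_itv/= -EFinD; case: ifP; rewrite ltry.
apply/eqP; rewrite -measure_le0; apply/lee_addgt0Pr => e e0.
have [K [cK KS KSe]] := lebesgue_regularity_inner mS finS e0.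
have K0 : lebesgue_measure K = 0.
  apply/eqP; rewrite -measure_le0; apply/lee_addgt0Pr => d d0.
  rewrite add0e.
  pose n := Num.truncn (6 / d).
  apply: (@le_trans _ _ (6 / n.+1%:R)%:E).
    by apply: (compact_steep_le varG) => // x /KS[_ /(_ n)]; apply.
  rewrite lee_fin ler_pdivrMr// mulrC -ler_pdivrMr//; apply: ltW.
  exact: truncnS_gt.
have mK : measurable K by exact: compact_measurable.
rewrite add0e -(setDUK KS).
have U2 := @measureU2 _ (measurableTypeR R) R lebesgue_measure _ _
  mK (measurableD mS mK).
by apply: (le_trans U2); rewrite [X in (X + _)%E]K0 add0e ltW.
Qed.

(** * Slopes, and differentiability of absolutely continuous functions *)

(** A division-free form of [is_derive x 1 f l], convenient for inequalities; the next two lemmas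
    give the equivalence. *)
Definition has_slope (R : realType) (f : R -> R) (x l : R) : Prop :=
  forall e : R, 0 < e -> exists2 d : R, 0 < d & forall y, `|y - x| < d ->
    `|f y - f x - l * (y - x)| <= e * `|y - x|.

Lemma is_derive_slope (R : realType) (f : R -> R) (x l : R) :
  is_derive x 1 f l -> has_slope f x l.
Proof.
move=> [df <-] e e0.
have /cvgrPdist_le /(_ e e0) : h^-1 *: (f (h *: 1 + x) - f x) @[h --> 0^'] --> 'D_1 f x.
  exact: df.
move=> /nbhs_ballP[d /= d0 dP]; exists d => // y yd.
have [->|yx] := eqVneq y x; first by rewrite !subrr mulr0 subrr normr0 mulr0.
have yx0 : y - x != 0 by rewrite subr_eq0.
have := dP (y - x); rewrite /ball/= sub0r normrN => /(_ yd yx0).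
rewrite scaler1 subrK => H.
rewrite -ler_pdivrMr ?normr_gt0// -normfV -normrM -normrN.
apply: le_trans H; rewrite le_eqVlt; apply/orP; left; apply/eqP; congr `|_|.
by rewrite /GRing.scale/=; field.
Qed.

Lemma slope_is_derive (R : realType) (f : R -> R) (x l : R) :
  has_slope f x l -> is_derive x 1 f l.
Proof.
move=> fl.
have H : h^-1 *: ((f \o shift x) (h *: (1 : R)) - f x) @[h --> 0^'] --> l.
  apply/cvgrPdist_le => e e0; have [d d0 dP] := fl e e0.
  apply/nbhs_ballP; exists d => //= h; rewrite /ball/= sub0r normrN => hd h0.
  have := dP (h + x); rewrite addrK => /(_ hd).
  rewrite -ler_pdivrMr ?normr_gt0// -normfV -normrM -normrN.
  apply: le_trans; rewrite le_eqVlt; apply/orP; left; apply/eqP; congr `|_|.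
  by rewrite /GRing.scale/= mulr1; field.
split; first by apply/cvg_ex; exists l.
exact/cvg_lim.
Qed.

Lemma squeeze_slope (R : realType) (lo f hi : R -> R) (x l1 l2 : R) :
  (forall y, lo y <= f y) -> (forall y, f y <= hi y) ->
  lo x = f x -> hi x = f x ->
  has_slope lo x l1 -> has_slope hi x l2 -> has_slope f x l1.
Proof.
move=> lof fhi lox hix H1 H2.
have l12 : l1 = l2.
  apply/eqP; rewrite -subr_eq0 -normr_eq0 -normr_le0; apply/ler_addgt0Pr => e e0.
  have e20 : 0 < e / 2 by lra.
  have [d1 d10 P1] := H1 _ e20; have [d2 d20 P2] := H2 _ e20.
  pose t := Num.min d1 d2 / 2.
  have [t0 t1 t2] : [/\ 0 < t, t < d1 & t < d2].
    by rewrite /t /Num.min; case: ifP; split; lra.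
  (* Comparing [lo] and [hi] at distance [t] on both sides of [x] bounds [l1 - l2] by [e] from above
     and from below. *)
  have Q s : `|s| = t -> lo x + l1 * s - e / 2 * t <= hi x + l2 * s + e / 2 * t.
    move=> st; have := P1 (x + s); have := P2 (x + s).
    rewrite (addrC x) addrK st => /(_ t2) + /(_ t1).
    rewrite !ler_norml => /andP[_ A] /andP[B _].
    by have := lof (s + x); have := fhi (s + x); lra.
  have := Q t; have := Q (- t).
  rewrite normrN (gtr0_norm t0) => /(_ erefl) A /(_ erefl) B.
  rewrite add0r normr_id ler_norml; rewrite lox hix in A B.
  by apply/andP; split; rewrite -(ler_pM2r t0); lra.
rewrite -l12 in H2 => e e0.
have [d1 d10 P1] := H1 _ e0; have [d2 d20 P2] := H2 _ e0.
exists (Num.min d1 d2); first by rewrite lt_min d10.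
move=> y; rewrite lt_min => /andP[/P1 + /P2]; rewrite lox hix.
rewrite !ler_norml => /andP[A B] /andP[C D].
have lofy := lof y; have fhiy := fhi y.
by apply/andP; split; lra.
Qed.

(** McShane's extension: the supremum of the cones [G x - n * |y - x|] with apex at the points [x]
    where the pointwise bound holds. That bound keeps each cone below [G]; [x0] makes the supremum
    nonempty. *)
Lemma lipschitz_minorant (R : realType) (n : R) (G : R -> R) (x0 : R) :
  (forall y, `|G y - G x0| <= n * `|y - x0|) ->
  exists lo : R -> R, [/\ forall x y, `|lo x - lo y| <= n * `|x - y|,
    forall y, lo y <= G y &
    forall x, (forall y, `|G y - G x| <= n * `|y - x|) -> lo x = G x].
Proof.
move=> x0P.
pose A := [set x | forall y, `|G y - G x| <= n * `|y - x|].
pose E y := [set G x - n * `|y - x| | x in A].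
have Eub y : ubound (E y) (G y).
  by move=> _ [x Ax <-]; have := Ax y; rewrite ler_norml => /andP[+ _]; lra.
have E0 y : E y !=set0 by exists (G x0 - n * `|y - x0|); exists x0.
have Esup y : has_sup (E y) by split; [exact: E0|exists (G y); exact: Eub].
have n0 : 0 <= n.
  have := x0P (x0 + 1); rewrite (addrC x0) addrK normr1 mulr1.
  exact: le_trans.
have loL x y : sup (E x) <= sup (E y) + n * `|x - y|.
  apply: ge_sup; first exact: E0.
  move=> _ [z Az <-].
  have : G z - n * `|y - z| <= sup (E y).
    by apply: ub_le_sup; [exists (G y); exact: Eub|exists z].
  have := ler_distD x y z; rewrite (distrC y x) => H.
  have := ler_wpM2l n0 H; lra.
exists (fun y => sup (E y)); split.
- move=> x y; rewrite ler_norml; have := loL x y; have := loL y x.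
  by rewrite (distrC y x); lra.
- by move=> y; apply: ge_sup; [exact: E0|exact: Eub].
- move=> x Ax; apply/le_anti/andP; split.
    by apply: ge_sup; [exact: E0|exact: Eub].
  apply: ub_le_sup; first by exists (G x); exact: Eub.
  by exists x => //; rewrite subrr normr0 mulr0 subr0.
Qed.

(* Stepanov's argument: on the set where [G] satisfies a pointwise Lipschitz
   bound [n], it is pinched between two [n]-Lipschitz functions that touch it. *)
Lemma pointwise_lipschitz_ae_derivable (R : realType) (n : R) (G : R -> R) (u v : R) :
  0 < n ->
  {ae (@lebesgue_measure R), forall x, x \in `]u, v[ ->
    (forall y, `|G y - G x| <= n * `|y - x|) -> derivable G x 1}.
Proof.
move=> n0.
have [[x0 x0P]|nA] :=
  pselect (exists x0, forall y, `|G y - G x0| <= n * `|y - x0|); last first.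
  by apply: aeW => x _ xP; exfalso; apply: nA; exists x.
have [lo [loL loG loE]] := lipschitz_minorant x0P.
(* The upper function is [\- hi], the negative of a minorant of [\- G]. *)
have [|hi [hiL hiG hiE]] := @lipschitz_minorant R n (\- G) x0.
  by move=> y /=; rewrite -opprD normrN.
have := ae_and (lipschitz_ae_derivable u v n0 loL) (lipschitz_ae_derivable u v n0 hiL).
apply: ae_mono => x [d1 d2] xuv xP.
have D1 : is_derive x 1 lo ('D_1 lo x) by apply: DeriveDef => //; exact: d1.
have D2 : is_derive x 1 hi ('D_1 hi x) by apply: DeriveDef => //; exact: d2.
have D3 : is_derive x 1 (\- hi) (- 'D_1 hi x) by exact: is_deriveN.
suff [] : is_derive x 1 G ('D_1 lo x) by [].
apply: slope_is_derive.
apply: (@squeeze_slope R lo G (\- hi) x _ (- 'D_1 hi x)) => //=.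
- by move=> y; have := hiG y; rewrite /=; lra.
- exact: loE.
- rewrite (_ : hi x = - G x) ?opprK//.
  by apply: hiE => y /=; rewrite -opprD normrN.
- exact: is_derive_slope.
- exact: is_derive_slope.
Qed.

Lemma small_variation_continuous (R : realType) (G : R -> R) :
  (forall e : R, 0 < e -> exists2 d : R, 0 < d & small_variation G d e) -> continuous G.
Proof.
move=> Gac x; apply/cvgrPdist_lt => e e0; have [d d0 dP] := Gac e e0.
apply/nbhs_ballP; exists d => //= y; rewrite /ball/= => xyd.
have := dP unit [:: tt] (fun _ => Num.min x y) (fun _ => Num.max x y).
rewrite !big_seq1 /Num.min /Num.max; case: ifP => xy.
  rewrite distrC; apply => //; first by move=> _ _; lra.
    by move=> [] [].
  by move: xyd; rewrite distrC ger0_norm; lra.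
apply => //; first by move=> _ _; lra.
  by move=> [] [].
by move: xyd; rewrite ger0_norm; lra.
Qed.

(** Almost every [x] fails to be steep for some [n], and the Lipschitz bound at [x] with constant
    [n.+1] then gives the derivative, outside a countable union of null sets. *)
Lemma ac_ae_derivable (R : realType) (G : R -> R) (u v : R) :
  (forall e : R, 0 < e -> exists2 d : R, 0 < d & small_variation G d e) ->
  variation_lt G 1 ->
  {ae (@lebesgue_measure R), forall x, x \in `]u, v[ -> derivable G x 1}.
Proof.
move=> Gac varG.
have cG := small_variation_continuous Gac.
have S0 : {ae (@lebesgue_measure R), forall x,
    ~ (`[u, v]%classic `&` \bigcap_n steep_points G n) x}.
  exists (`[u, v]%classic `&` \bigcap_n steep_points G n); split.
  - apply: measurableI => //; apply: bigcapT_measurable => n.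
    by apply: open_measurable; exact: open_steep_points.
  - exact: steep_points_null.
  - by move=> x /= /contrapT.
have An := ae_foralln (fun n => pointwise_lipschitz_ae_derivable G u v (ltr0Sn R n)).
have := ae_and S0 An.
apply: ae_mono => x [xS xA] xuv.
have [n nP] : exists n : nat, ~ steep_points G n x.
  apply: contrapT => /forallNP H; apply: xS; split.
    by move: xuv; rewrite /= !in_itv/= => /andP[/ltW -> /ltW ->].
  by move=> n _; apply: contrapT; exact: H.
apply: (xA n) => // y; rewrite leNgt; apply/negP => h; apply: nP.
by exists y.
Qed.

(** * From a bound on the derivative to a Lipschitz bound *)

(** The local step at the supremum of the good points starts from a good point just before it and
    would carry goodness past it, unless [v] is reached. *)
Lemma real_induction (R : realType) (u v : R) (good : R -> Prop) : u <= v ->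
  good u ->
  (forall z, u <= z <= v -> exists2 d : R, 0 < d & forall x y,
     u <= x -> x <= z -> z <= y -> y <= v -> z - x < d -> y - z < d ->
     good x -> good y) ->
  good v.
Proof.
move=> uv gu loc.
pose A := [set x | u <= x <= v /\ good x].
have Au : A u by split => //; lra.
have supA : has_sup A by split; [exists u|exists v => x [] /andP[]].
have su : u <= sup A by apply: ub_le_sup => //; case: supA.
have sv : sup A <= v by apply: ge_sup; [exists u|move=> x [] /andP[]].
have [|d d0 dP] := loc (sup A); first by rewrite su.
have [x [/andP[ux xv] gx] xs] := sup_adherent d0 supA.
have xs2 : x <= sup A by apply: ub_le_sup; [case: supA|split => //; rewrite ux].
have gs y : sup A <= y -> y <= v -> y - sup A < d -> good y.
  by move=> sy yv yd; apply: dP gx => //; lra.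
have [vd|dv] := ltP (v - sup A) d; first exact: gs.
have gy : A (sup A + d / 2).
  by split; [lra|apply: gs; lra].
have : sup A + d / 2 <= sup A by apply: ub_le_sup => //; case: supA.
lra.
Qed.

Lemma null_open_cover (R : realType) (N : set R) (d : R) :
  (@lebesgue_measure R).-negligible N -> 0 < d ->
  exists U : set R, [/\ open U, N `<=` U & (@lebesgue_measure R U < d%:E)%E].
Proof.
move=> [A [mA A0 NA]] d0.
have Afin : (@lebesgue_measure R A < +oo)%E by rewrite A0 ltry.
have [U [oU AU UA]] := lebesgue_regularity_outer mA Afin d0.
exists U; split => //; first exact: subset_trans AU.
have mU : measurable U by exact: open_measurable.
have U2 := @measureU2 _ (measurableTypeR R) R lebesgue_measure _ _
  mA (measurableD mU mA).
apply: le_lt_trans UA; rewrite -[in leLHS](setDUK AU).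
by apply: (le_trans U2); rewrite [X in (X + _)%E]A0 add0e.
Qed.

(* Outside a small open set [U] containing the exceptional points, the increments
   of [G] are controlled by the derivative; inside [U] by absolute continuity. *)
Lemma ac_increment_le (R : realType) (G : R -> R) (u v M : R) : u <= v -> 0 <= M ->
  (forall e : R, 0 < e -> exists2 d : R, 0 < d & small_variation G d e) ->
  {ae (@lebesgue_measure R), forall x, x \in `]u, v[ ->
     derivable G x 1 /\ derive1 G x <= M} ->
  G v - G u <= M * (v - u).
Proof.
move=> uv M0 Gac Gae.
suff H e : 0 < e -> G v - G u <= (M + e) * (v - u) + e.
  apply/ler_addgt0Pr => e e0.
  pose e' := e / (v - u + 1).
  have e'0 : 0 < e' by rewrite divr_gt0//; lra.
  have := H _ e'0; have -> : e = e' * (v - u + 1) by rewrite /e' divfK//; lra.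
  lra.
move=> e0; have [d d0 dP] := Gac e e0.
(* Adding [u] and [v] to the exceptional set ensures that a point of [[u, v]] outside [U] is
   interior. *)
pose N := ~` [set x | x \in `]u, v[ -> derivable G x 1 /\ derive1 G x <= M]
  `|` [set u] `|` [set v].
have Nnull : (@lebesgue_measure R).-negligible N.
  apply: negligibleU; last first.
    by exists [set v]; split => //; exact: lebesgue_measure_set1.
  apply: negligibleU => //.
  by exists [set u]; split => //; exact: lebesgue_measure_set1.
have [U [oU NU Ud]] := null_open_cover Nnull d0.
(* [s] records the intervals inside [U] crossed so far, all ending by [x]. Their total length stays
   below [d], so at [v] their increments sum to less than [e]. *)
pose fam x (s : seq (R * R)) := [/\ uniq s,
  forall p, p \in s -> p.1 <= p.2 <= x,
  forall p, p \in s -> `]p.1, p.2[%classic `<=` U &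
  trivIset [set` s] (fun p => `]p.1, p.2[%classic)].
pose good x := exists2 s, fam x s &
  G x - G u <= (M + e) * (x - u) + \sum_(p <- s) `|G p.2 - G p.1|.
suff [s [us sle sU ts] Gs] : good v.
  apply: (le_trans Gs); rewrite lerD2l ltW//.
  have s12 p : p \in s -> p.1 <= p.2 by move=> /sle/andP[].
  apply: (dP _ _ _ _ us s12 ts); rewrite -lte_fin; apply: le_lt_trans Ud.
  by apply: sum_disjoint_itv_le => //; exact: open_measurable.
have famW x y s : x <= y -> fam x s -> fam y s.
  move=> xy [us sle sU ts]; split => // p /sle /andP[-> h].
  exact: le_trans xy.
apply: (real_induction uv).
  by exists [::]; [split => //; move=> ? ? //|rewrite big_nil; lra].
(* Crossing a point of [U] appends [(x, y)] to the list; at a point outside [U] the derivative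
   bounds the increment and the list is kept. *)
move=> z uzv; have [Uz|nUz] := pselect (U z).
  have /nbhs_ballP[r /= r0 rU] : nbhs z U by exact: open_nbhs_nbhs.
  exists r => // x y ux xz zy yv zx yz [s [us sle sU ts] Gs].
  have [xy|yx] := ltP x y; last first.
    have -> : y = x by lra.
    by exists s.
  have nxs : (x, y) \notin s by apply/negP => /sle /= /andP[]; lra.
  exists ((x, y) :: s); last first.
    have Mxy : 0 <= (M + e) * (y - x) by apply: mulr_ge0; lra.
    by rewrite big_cons/=; have := ler_norm (G y - G x); lra.
  split => /=.
  - by rewrite nxs.
  - move=> p; rewrite inE => /predU1P[->/=|/sle]; lra.
  - move=> p; rewrite inE => /predU1P[-> t|/sU//].
    rewrite /= in_itv/= => /andP[xt ty]; apply: rU.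
    by rewrite /ball/= ltr_norml; lra.
  - have disj p t : p \in s -> `]p.1, p.2[%classic t -> `]x, y[%classic t -> False.
      by move=> /sle; rewrite /= !in_itv/=; lra.
    move=> p q /=; rewrite !inE => /predU1P[->|ps] /predU1P[->|qs] //= [t [pt qt]].
    + by case: (disj _ _ qs qt pt).
    + by case: (disj _ _ ps pt qt).
    + by apply: ts => //; exists t.
have zN : ~ N z by move=> /NU.
have zoo : z \in `]u, v[.
  have zu : z <> u by move=> zu; apply: zN; left; right.
  have zv : z <> v by move=> zv; apply: zN; right.
  rewrite in_itv/= !lt_neqAle; case/andP: uzv => -> ->; rewrite !andbT.
  by apply/andP; split; apply/eqP => // /esym.
have [dG GM] : derivable G z 1 /\ derive1 G z <= M.
  by apply: contrapT => h; apply: zN; left; left => /(_ zoo).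
have D : is_derive z 1 G (derive1 G z) by rewrite derive1E; apply: DeriveDef.
have [r r0 rP] := is_derive_slope D e0.
exists r => // x y ux xz zy yv zx yz [s fs Gs].
exists s; first by apply: famW fs; lra.
have : `|x - z| < r by rewrite ltr_norml; lra.
move=> /rP; rewrite (ler0_norm (_ : x - z <= 0)) ?subr_le0// ler_norml => /andP[A _].
have : `|y - z| < r by rewrite ltr_norml; lra.
move=> /rP; rewrite (ger0_norm (_ : 0 <= y - z)) ?subr_ge0// ler_norml => /andP[_ B].
nra.
Qed.

Lemma abs_continuousN (R : realType) (a b : R) (g : R -> R) :
  abs_continuous a b g -> abs_continuous a b (fun x => - g x).
Proof.
move=> acg e e0; have [d d0 dP] := acg e e0; exists d => // n x y xy txy xyd.
under eq_bigr do rewrite -opprD normrN; exact: dP.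
Qed.

(** The interval is short so that the clamped function has variation below 1 and is differentiable
    almost everywhere; inside []u, v[] it coincides locally with [g]. *)
Lemma ac_local_increment (R : realType) (a b M : R) (g : R -> R) :
  abs_continuous a b g -> 0 <= M ->
  {ae (@lebesgue_measure R), forall x, x \in `]a, b[ ->
     derivable g x 1 -> derive1 g x <= M} ->
  exists2 d : R, 0 < d & forall u v, a <= u -> u <= v -> v <= b -> v - u < d ->
    g v - g u <= M * (v - u).
Proof.
move=> acg M0 gae; have [d d0 dP] := small_variation_clamp acg ltr01.
exists d => // u v au uv vb uvd.
pose G := g \o clamp u v.
have Gac e : 0 < e -> exists2 d : R, 0 < d & small_variation G d e.
  move=> e0; have [r r0 rP] := small_variation_clamp acg e0.
  by exists r => //; exact: rP.
have varG := variation_clamp (dP u v au uv vb) uv uvd.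
have := ac_ae_derivable u v Gac varG.
move=> /(ae_and gae) Gae.
have GE x : u <= x <= v -> G x = g x by move=> xuv; rewrite /G /= clamp_id.
have := @ac_increment_le R G u v M uv M0 Gac.
rewrite !GE ?lexx ?uv//; apply; apply: ae_mono Gae => x [H1 H2] xuv.
have dG := H2 xuv; split => //.
have near_eq : \forall y \near x, G y = g y.
  near=> y; rewrite GE//; apply/andP; split; apply/ltW; near: y.
    by apply: lt_nbhsr; move: xuv; rewrite in_itv/= => /andP[].
  by apply: lt_nbhsl; move: xuv; rewrite in_itv/= => /andP[].
rewrite derive1E (near_eq_derive _ near_eq) -derive1E; apply: H1.
  by move: xuv; rewrite !in_itv/=; lra.
exact: (near_eq_derivable near_eq dG).
Unshelve. all: end_near. Qed.

Lemma ac_increment_cc (R : realType) (a b M : R) (g : R -> R) :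
  abs_continuous a b g -> 0 <= M ->
  {ae (@lebesgue_measure R), forall x, x \in `]a, b[ ->
     derivable g x 1 -> derive1 g x <= M} ->
  forall u v, a <= u -> u <= v -> v <= b -> g v - g u <= M * (v - u).
Proof.
move=> acg M0 gae u v au uv vb.
have [d d0 dP] := ac_local_increment acg M0 gae.
apply: (@real_induction R u v (fun x => g x - g u <= M * (x - u)) uv); first lra.
(* Points within [d / 2] of [z] on either side are less than [d] apart. *)
move=> z uzv; exists (d / 2); first lra.
move=> x y ux xz zy yv zx yz Gx.
have := dP x y; have xy : x <= y by lra.
rewrite xy => H.
have : g y - g x <= M * (y - x) by apply: H => //; lra.
lra.
Qed.

Lemma ac_lipschitz (R : realType) (a b M : R) (g : R -> R) :
  abs_continuous a b g -> 0 <= M ->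
  {ae (@lebesgue_measure R), forall x, x \in `]a, b[ ->
     derivable g x 1 -> `|derive1 g x| <= M} ->
  forall x y, a <= x -> x <= y -> y <= b -> `|g y - g x| <= M * (y - x).
Proof.
move=> acg M0 gae x y ax xy yb; rewrite ler_norml; apply/andP; split.
  have := @ac_increment_cc R a b M _ (abs_continuousN acg) M0 _ x y ax xy yb.
  rewrite lerNl => H; have : - g y - - g x <= M * (y - x); last lra.
  apply: H; apply: ae_mono gae => z zP zab dz.
  have dg : derivable g z 1.
    have := derivableN dz; apply: eq_derivable => t.
    by rewrite /= opprK.
  have -> : derive1 (fun x => - g x) z = - derive1 g z.
    by rewrite !derive1E; exact: deriveN.
  by have := zP zab dg; rewrite ler_norml; lra.
apply: (ac_increment_cc acg M0) => //; apply: ae_mono gae => z zP zab dz.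
by have := zP zab dz; rewrite ler_norml; lra.
Qed.

(** * The essential supremum norm and derivatives relative to [[a, b]] *)

Lemma Loo_norm_ae (R : realType) (a b : R) (h : R -> R) :
  {ae (@lebesgue_measure R), forall x, x \in `[a, b] ->
     (`|h x|%:E <= Loo_norm_cc a b h)%E}.
Proof.
rewrite /Loo_norm_cc unlock.
(* The definition of the norm tests whether the whole space has positive measure. *)
have -> : (0 < @lebesgue_measure R setT)%E.
  by rewrite -set_itvNyy [ltRHS]lebesgue_measure_itv/= ltry.
have := ess_sup_inf.ess_sup_ge (@lebesgue_measure R)
  (abse \o (EFin \o h \_ `[a, b]%classic)).
apply: ae_mono => x + xab; rewrite /= patchE mem_set//.
Qed.

Lemma Loo_cc_fin (R : realType) (a b : R) (h : R -> R) :
  Loo_cc a b h -> exists2 M : R, 0 <= M & Loo_norm_cc a b h = M%:E.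
Proof.
move=> /andP[_]; rewrite inE /= /finite_norm -/(Loo_norm_cc a b h) => h1.
have h0 : (0 <= Loo_norm_cc a b h)%E by exact: Lnorm_ge0.
exists (fine (Loo_norm_cc a b h)); first exact: fine_ge0.
by rewrite fineK// ge0_fin_numE.
Qed.

Lemma admissible_lipschitz (R : realType) (a b M : R) (f : R -> R) :
  admissible a b f -> 0 <= M ->
  Loo_norm_cc a b (derive_cc a b (derive_cc a b f)) = M%:E ->
  forall x y, a <= x -> x <= y -> y <= b ->
    `|derive_cc a b f y - derive_cc a b f x| <= M * (y - x).
Proof.
move=> [_ ac _] M0 NM; apply: (ac_lipschitz ac M0).
apply: ae_mono (Loo_norm_ae a b (derive_cc a b (derive_cc a b f))) => x + xab _.
rewrite NM lee_fin (derive_ccE _ xab).1; apply.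
exact: subset_itv_oo_cc xab.
Qed.

Lemma derivable_cc_slope (R : realType) (a b : R) (f : R -> R) (x : R) :
  derivable_cc a b f x ->
  forall e : R, 0 < e -> exists2 d : R, 0 < d &
    forall y, a <= y <= b -> `|y - x| < d ->
    `|f y - f x - derive_cc a b f x * (y - x)| <= e * `|y - x|.
Proof.
move=> df e e0.
have /cvgrPdist_le /(_ e e0) :
  (f y - f x) / (y - x) @[y --> within `[a, b]%classic x^'] --> derive_cc a b f x.
  exact: df.
move=> /nbhs_ballP[d /= d0 dP]; exists d => // y yab yd.
have [->|yx] := eqVneq y x; first by rewrite !subrr mulr0 subrr normr0 mulr0.
have yx0 : y - x != 0 by rewrite subr_eq0.
have := dP y; rewrite /ball/= distrC => /(_ yd yx yab) H.
rewrite -ler_pdivrMr ?normr_gt0// -normfV -normrM -normrN.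
apply: le_trans H; rewrite le_eqVlt; apply/orP; left; apply/eqP; congr `|_|.
by field.
Qed.

Lemma slope_derivable_cc (R : realType) (a b : R) (f : R -> R) (x l : R) :
  a < b -> a <= x <= b ->
  (forall e : R, 0 < e -> exists2 d : R, 0 < d &
    forall y, a <= y <= b -> `|y - x| < d ->
    `|f y - f x - l * (y - x)| <= e * `|y - x|) ->
  derivable_cc a b f x /\ derive_cc a b f x = l.
Proof.
move=> ab xab fl.
have H : (f y - f x) / (y - x) @[y --> within `[a, b]%classic x^'] --> l.
  apply/cvgrPdist_le => e e0; have [d d0 dP] := fl e e0.
  apply/nbhs_ballP; exists d => //= y; rewrite /ball/= distrC => yd yx yab.
  have yx0 : y - x != 0 by rewrite subr_eq0.
  have := dP y yab yd.
  rewrite -ler_pdivrMr ?normr_gt0// -normfV -normrM -normrN.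
  apply: le_trans; rewrite le_eqVlt; apply/orP; left; apply/eqP; congr `|_|.
  by field.
(* Properness makes the limit unique: [[a, b]] has points close to [x] and different from it, to the
   right for [x] in the left half and to the left otherwise. *)
have PF : ProperFilter (within `[a, b]%classic x^').
  apply: Build_ProperFilter_ex => P /nbhs_ballP[d /= d0 dP].
  pose t := Num.min d (b - a) / 2.
  have [t0 td tb] : [/\ 0 < t, t < d & t <= (b - a) / 2].
    by rewrite /t /Num.min; case: ifP; split; lra.
  have [xm|mx] := leP x ((a + b) / 2).
    exists (x + t); apply: dP.
    - by rewrite /ball/= distrC addrAC subrr add0r gtr0_norm.
    - by rewrite -subr_eq0 addrAC subrr add0r gt_eqF.
    - by rewrite /= in_itv/=; lra.
  exists (x - t); apply: dP.
  - by rewrite /ball/= opprB addrCA subrr addr0 gtr0_norm.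
  - by rewrite -subr_eq0 addrAC subrr add0r oppr_eq0 gt_eqF.
  - by rewrite /= in_itv/=; lra.
split; first by apply/cvg_ex; exists l.
exact: (cvg_lim _ H).
Qed.

Lemma derive_cc_is_derive (R : realType) (a b : R) (f : R -> R) (x l : R) :
  a < b -> a <= x <= b -> is_derive x 1 f l ->
  derivable_cc a b f x /\ derive_cc a b f x = l.
Proof.
move=> ab xab D; apply: slope_derivable_cc => // e e0.
have [d d0 dP] := is_derive_slope D e0.
by exists d => // y _; exact: dP.
Qed.

Lemma derivable_cc_continuous (R : realType) (a b : R) (f : R -> R) :
  (forall x, x \in `[a, b] -> derivable_cc a b f x) ->
  {within `[a, b], continuous f}.
Proof.
move=> df; apply/subspace_continuousP => x xab.
have := derivable_cc_slope (df x xab); set l := derive_cc a b f x.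
move=> /(_ 1 ltr01)[d d0 dP].
apply/cvgrPdist_le => e e0.
have l0 : 0 < `|l| + 1 by rewrite ltr_wpDl.
have r0 : 0 < Num.min d (e / (`|l| + 1)) by rewrite lt_min d0 divr_gt0.
apply/nbhs_ballP; exists (Num.min d (e / (`|l| + 1))) => //= y.
rewrite /ball/= lt_min => /andP[yd ye]; rewrite in_itv/= => yab.
rewrite distrC in yd; have := dP y yab yd; rewrite mul1r => H.
have -> : f x - f y = - (f y - f x - l * (y - x)) - l * (y - x) by ring.
apply: (le_trans (ler_normB _ _)); rewrite normrN normrM.
apply: (@le_trans _ _ ((`|l| + 1) * `|y - x|)); first by rewrite mulrDl mul1r; lra.
by rewrite distrC mulrC -ler_pdivlMr// ltW.
Qed.

Lemma within_continuousB (R : realType) (A : set R) (f g : R -> R) :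
  {within A, continuous f} -> {within A, continuous g} ->
  {within A, continuous (fun x => f x - g x)}.
Proof.
move=> /subspace_continuousP cf /subspace_continuousP cg.
by apply/subspace_continuousP => x Ax; apply: cvgB; [exact: cf|exact: cg].
Qed.

Lemma within_continuousM (R : realType) (A : set R) (f g : R -> R) :
  {within A, continuous f} -> {within A, continuous g} ->
  {within A, continuous (fun x => f x * g x)}.
Proof.
move=> /subspace_continuousP cf /subspace_continuousP cg.
by apply/subspace_continuousP => x Ax; apply: cvgM; [exact: cf|exact: cg].
Qed.

(** * The upper bound for the error *)

Lemma nonneg_derive_le (R : realType) (P : R -> R) (dP : R -> R) (p q : R) :
  p <= q -> (forall x, x \in `]p, q[ -> is_derive x 1 P (dP x)) ->
  {within `[p, q], continuous P} ->
  (forall x, x \in `]p, q[ -> 0 <= dP x) -> P p <= P q.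
Proof.
rewrite le_eqVlt => /predU1P[->//|pq] D cP dP0.
have [x xpq E] := MVT pq D cP.
by rewrite -subr_ge0 E mulr_ge0// ?dP0// subr_ge0 ltW.
Qed.

(** The left side is the increment of the primitive of [2 * (x - c) * (k + m * (x - c))]; the sign
    condition makes [P] minus this primitive nondecreasing. *)
Lemma segment_bound (R : realType) (P g : R -> R) (c k m p q : R) : p <= q ->
  (forall x, x \in `]p, q[ -> is_derive x 1 P (2 * (x - c) * g x)) ->
  {within `[p, q], continuous P} ->
  (forall x, p < x < q -> 0 <= (g x - (k + m * (x - c))) * (x - c)) ->
  k * (q - c) ^+ 2 + 2 / 3 * m * (q - c) ^+ 3
    - (k * (p - c) ^+ 2 + 2 / 3 * m * (p - c) ^+ 3) <= P q - P p.
Proof.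
move=> pq D cP gP.
pose Q : {poly R} := k *: ('X - c%:P) ^+ 2 + (2 / 3 * m) *: ('X - c%:P) ^+ 3.
have QE x : Q.[x] = k * (x - c) ^+ 2 + 2 / 3 * m * (x - c) ^+ 3.
  by rewrite /Q !hornerE.
have dQE x : Q^`().[x] = 2 * (x - c) * (k + m * (x - c)).
  rewrite /Q derivD !derivZ !deriv_exp derivB derivX derivC subr0 !mul1r.
  rewrite /= !(hornerD, hornerN, hornerX, hornerC, hornerZ, hornerMn, horner_exp)/=.
  by field.
rewrite -!QE.
have : P p - Q.[p] <= P q - Q.[q]; last lra.
apply: (@nonneg_derive_le R (P - horner Q)
  (fun x => 2 * (x - c) * g x - Q^`().[x]) p q pq).
- by move=> x /D Dx; apply: is_deriveB.
- apply: (within_continuousB cP).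
  by apply: continuous_subspaceT; exact: continuous_horner.
- move=> x; rewrite in_itv/= => /gP; rewrite dQE; nra.
Qed.

(* The extremal [g] has slopes M, -M, M on the three intervals cut out by the roots
   of the quadratic; [g] is compared there with the lines of these slopes through
   its values at [a], at the midpoint and at [b]. *)
Lemma weighted_bound (R : realType) (a b M : R) (g P : R -> R) : a < b ->
  (forall x y, a <= x -> x <= y -> y <= b -> `|g y - g x| <= M * (y - x)) ->
  (forall x, x \in `]a, b[ -> is_derive x 1 P (2 * (x - (a + b) / 2) * g x)) ->
  {within `[a, b], continuous P} ->
  3 * ((b - a) / 4) ^+ 2 * (g b - g a) - (P b - P a)
    <= 4 * M * ((b - a) / 4) ^+ 3.
Proof.
move=> ab gL D cP.
pose c := (a + b) / 2; pose al := (b - a) / 4.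
have seg p q k m : a <= p -> p <= q -> q <= b ->
    (forall x, p < x < q -> 0 <= (g x - (k + m * (x - c))) * (x - c)) ->
    k * (q - c) ^+ 2 + 2 / 3 * m * (q - c) ^+ 3
      - (k * (p - c) ^+ 2 + 2 / 3 * m * (p - c) ^+ 3) <= P q - P p.
  move=> ap pq qb H.
  have Dpq x : x \in `]p, q[ -> is_derive x 1 P (2 * (x - c) * g x).
    by rewrite in_itv/= => xpq; apply: D; rewrite in_itv/=; lra.
  have cPpq : {within `[p, q], continuous P}.
    by apply: continuous_subspaceW cP => x /=; rewrite !in_itv/=; lra.
  exact: (@segment_bound R P g c k m p q pq Dpq cPpq H).
(* The argument before the slope is the value at [c] of the comparison line. *)
have S1 : _ := @seg a (c - al) (g a + M * (c - a)) M _ _ _ _.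
have S2 : _ := @seg (c - al) (c + al) (g c) (- M) _ _ _ _.
have S3 : _ := @seg (c + al) b (g b + M * (c - b)) M _ _ _ _.
have {}S1 : (g a + M * (c - a)) * (c - al - c) ^+ 2 + 2 / 3 * M * (c - al - c) ^+ 3
  - ((g a + M * (c - a)) * (a - c) ^+ 2 + 2 / 3 * M * (a - c) ^+ 3) <= P (c - al) - P a.
  apply: S1; rewrite /c /al; [lra|lra|lra|].
  move=> x xI; have := gL a x; rewrite lexx => H.
  have : `|g x - g a| <= M * (x - a) by apply: H; lra.
  by rewrite ler_norml => /andP[_ A]; rewrite -mulrNN; apply: mulr_ge0; lra.
have {}S2 : g c * (c + al - c) ^+ 2 + 2 / 3 * - M * (c + al - c) ^+ 3
  - (g c * (c - al - c) ^+ 2 + 2 / 3 * - M * (c - al - c) ^+ 3)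
  <= P (c + al) - P (c - al).
  apply: S2; rewrite /al; [rewrite /c; lra|lra|rewrite /c; lra|].
  move=> x xI; have [xc|cx] := leP x c.
    have : `|g c - g x| <= M * (c - x) by apply: gL; rewrite /c in xI xc *; lra.
    by rewrite ler_norml => /andP[A _]; rewrite -mulrNN; apply: mulr_ge0; lra.
  have : `|g x - g c| <= M * (x - c) by apply: gL; rewrite /c in xI cx *; lra.
  by rewrite ler_norml => /andP[A _]; apply: mulr_ge0; lra.
have {}S3 : (g b + M * (c - b)) * (b - c) ^+ 2 + 2 / 3 * M * (b - c) ^+ 3
  - ((g b + M * (c - b)) * (c + al - c) ^+ 2 + 2 / 3 * M * (c + al - c) ^+ 3)
  <= P b - P (c + al).
  apply: S3; rewrite /c /al; [lra|lra|lra|].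
  move=> x xI; have : `|g b - g x| <= M * (b - x) by apply: gL; lra.
  by rewrite ler_norml => /andP[_ A]; apply: mulr_ge0; lra.
(* [3 * al ^+ 2] is the value of the quadratic at both endpoints, which are at distance [2 * al]
   from [c]. *)
have -> : 3 * ((b - a) / 4) ^+ 2 * (g b - g a) = 3 * al ^+ 2 * (g b - g a) by [].
rewrite -/al.
have ac : a = c - 2 * al by rewrite /c /al; lra.
have bc : b = c + 2 * al by rewrite /c /al; lra.
have E1 : (g a + M * (c - a)) * (c - al - c) ^+ 2 + 2 / 3 * M * (c - al - c) ^+ 3
  - ((g a + M * (c - a)) * (a - c) ^+ 2 + 2 / 3 * M * (a - c) ^+ 3)
  = - 3 * al ^+ 2 * g a - 6 * M * al ^+ 3 + 14 / 3 * M * al ^+ 3.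
  have -> : c - a = 2 * al by lra.
  have -> : a - c = - 2 * al by lra.
  by field.
have E3 : (g b + M * (c - b)) * (b - c) ^+ 2 + 2 / 3 * M * (b - c) ^+ 3
  - ((g b + M * (c - b)) * (c + al - c) ^+ 2 + 2 / 3 * M * (c + al - c) ^+ 3)
  = 3 * al ^+ 2 * g b - 6 * M * al ^+ 3 + 14 / 3 * M * al ^+ 3.
  have -> : c - b = - 2 * al by lra.
  have -> : b - c = 2 * al by lra.
  by field.
have E2 : g c * (c + al - c) ^+ 2 + 2 / 3 * - M * (c + al - c) ^+ 3
  - (g c * (c - al - c) ^+ 2 + 2 / 3 * - M * (c - al - c) ^+ 3)
  = - (4 / 3) * M * al ^+ 3.
  by field.
rewrite E1 in S1; rewrite E2 in S2; rewrite E3 in S3.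
lra.
Qed.

Lemma continuous_antiderivative (R : realType) (a b : R) (f : R -> R) : a < b ->
  {within `[a, b], continuous f} ->
  (forall x, x \in `]a, b[ -> derivable f x 1) ->
  exists F : R -> R,
  [/\ F a = 0, F b = \int[@lebesgue_measure R]_(t in `[a, b]) f t,
      {within `[a, b], continuous F} &
      forall x, x \in `]a, b[ -> is_derive x 1 F (f x)].
Proof.
move=> ab cf df.
pose F x := \int[@lebesgue_measure R]_(t in `[a, x]) f t; exists F.
have intf : (@lebesgue_measure R).-integrable `[a, b] (EFin \o f).
  by apply: continuous_compact_integrable => //; exact: segment_compact.
split => //.
- by rewrite /F set_itv1 Rintegral_set1.
- by apply: parameterized_integral_continuous => //; exact: ltW.
- move=> x; rewrite in_itv/= => /andP[ax xb].
  have xab : x \in `]a, b[ by rewrite in_itv/= ax.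
  have cfx : {for x, continuous f}.
    by apply: differentiable_continuous; apply/derivable1_diffP; exact: df.
  have [dF FE] := continuous_FTC1_closed xb intf ax cfx.
  by rewrite -FE derive1E; exact: (DeriveDef dF erefl).
Qed.

Lemma quad_error_phi1 (R : realType) (a b : R) (f : R -> R) :
  quad_error a b (('X - ((a + b) / 2)%:P) ^+ 2 - (((b - a) / 4) ^+ 2)%:P) f =
  \int[@lebesgue_measure R]_(x in `[a, b]) f x
  - (b - a) / 2 * (f a + f b)
  - 3 * (b - a) ^+ 2 / 32 * (derive_cc a b f a - derive_cc a b f b).
Proof.
rewrite /quad_error; set I := Rintegral _ _ _.
set phi := (X in X^`()).
have phiE x : phi.[x] = (x - (a + b) / 2) ^+ 2 - ((b - a) / 4) ^+ 2.
  by rewrite /phi !(hornerD, hornerN, hornerX, hornerC, horner_exp).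
have dphiE x : phi^`().[x] = 2 * (x - (a + b) / 2).
  rewrite /phi derivB derivC subr0 deriv_exp derivB derivX derivC subr0 mul1r.
  rewrite /= !(hornerD, hornerN, hornerX, hornerC, hornerMn, horner_exp)/=.
  by field.
by rewrite !phiE !dphiE; field.
Qed.

Lemma quad_error_phi1_le (R : realType) (a b M : R) (f : R -> R) : a < b ->
  admissible a b f -> 0 <= M ->
  Loo_norm_cc a b (derive_cc a b (derive_cc a b f)) = M%:E ->
  `|quad_error a b (('X - ((a + b) / 2)%:P) ^+ 2 - (((b - a) / 4) ^+ 2)%:P) f|
    <= M * ((b - a) ^+ 3 / 32).
Proof.
move=> ab fadm M0 NM; have gL := admissible_lipschitz fadm M0 NM.
have [fd _ _] := fadm; set g := derive_cc a b f in gL *.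
have cf := derivable_cc_continuous fd.
have dfg x : x \in `]a, b[ -> is_derive x 1 f (g x).
  move=> xab; have [gE dfx] := derive_ccE f xab.
  have {}dfx : derivable f x 1 := dfx.1 (fd x (subset_itv_oo_cc xab)).
  by rewrite /g gE derive1E; exact: (DeriveDef dfx erefl).
have df x : x \in `]a, b[ -> derivable f x 1 by move=> /dfg[].
have [F [Fa0 Fb cF dF]] := continuous_antiderivative ab cf df.
rewrite quad_error_phi1 -Fb -/g.
(* [P] is a primitive of the weight [2 * (x - c)] times [g], so the left side of [weighted_bound] is
   twice the error. *)
pose P x := 2 * (x - (a + b) / 2) * f x - 2 * F x.
have dP x : x \in `]a, b[ -> is_derive x 1 P (2 * (x - (a + b) / 2) * g x).
  move=> xab; pose l : {poly R} := 2 *: ('X - ((a + b) / 2)%:P).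
  have lE y : l.[y] = 2 * (y - (a + b) / 2) by rewrite /l hornerZ hornerXsubC.
  have dl := is_derive_poly l x.
  have := is_deriveB (is_deriveM dl (dfg x xab)) (is_deriveZ 2 (dF x xab)).
  rewrite /l derivZ derivB derivX derivC subr0 hornerZ hornerC.
  rewrite (_ : _ - _ = 2 * (x - (a + b) / 2) * g x); last first.
    by rewrite /GRing.scale/= hornerZ hornerXsubC; ring.
  by congr is_derive; apply/funext => y; rewrite /P !fctE -lE.
have cP : {within `[a, b], continuous P}.
  apply: within_continuousB; apply: within_continuousM => //.
    apply: continuous_subspaceT => y; apply: cvgM; first exact: cvg_cst.
    by apply: cvgB; [exact: cvg_id|exact: cvg_cst].
  by apply: continuous_subspaceT => y; exact: cvg_cst.
have U := weighted_bound ab gL dP cP.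
(* The same bound for [\- g] and [- P] controls the error from below. *)
have gLN x y : a <= x -> x <= y -> y <= b -> `|(\- g) y - (\- g) x| <= M * (y - x).
  by move=> ax xy yb; rewrite /= -opprD normrN gL.
have dPN x : x \in `]a, b[ -> is_derive x 1 (- P) (2 * (x - (a + b) / 2) * (\- g) x).
  by move=> /dP Dx; rewrite /= mulrN; exact: is_deriveN.
have cPN : {within `[a, b], continuous (- P)}.
  move/subspace_continuousP : cP => cP; apply/subspace_continuousP => x xab.
  by apply: cvgN; exact: cP.
have L := weighted_bound ab gLN dPN cPN.
rewrite !fctE /= in L; rewrite /P Fa0 in U L.
by rewrite ler_norml; apply/andP; split; lra.
Qed.

(** * Splines with second derivative 1, -1, 1 *)

Lemma quadratic_is_derive (R : realType) (f : R -> R) (x l r C : R) : 0 < r ->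
  (forall y, `|y - x| < r -> `|f y - f x - l * (y - x)| <= C * (y - x) ^+ 2) ->
  is_derive x 1 f l.
Proof.
move=> r0 fP; apply: slope_is_derive => e e0.
have C0 : 0 < `|C| + 1 by rewrite ltr_wpDl.
exists (Num.min r (e / (`|C| + 1))); first by rewrite lt_min r0 divr_gt0.
move=> y; rewrite lt_min => /andP[/fP H ye]; apply: (le_trans H).
rewrite ltr_pdivlMr// in ye.
rewrite -[X in _ * X]real_normK ?num_real// expr2 mulrA ler_wpM2r//.
have := ler_norm C; have := normr_ge0 (y - x); nra.
Qed.

Definition pos_part {R : realType} (t x : R) : R := Num.max (x - t) 0.

Lemma pos_part_le {R : realType} (t x : R) : x <= t -> pos_part t x = 0.
Proof. by move=> xt; rewrite /pos_part max_r// subr_le0. Qed.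

Lemma pos_part_ge {R : realType} (t x : R) : t <= x -> pos_part t x = x - t.
Proof. by move=> tx; rewrite /pos_part max_l// subr_ge0. Qed.

(* [spline t u] has second derivative 1, -1, 1 to the left of [t], between [t]
   and [u], and to the right of [u]. *)
Definition spline {R : realType} (t u x : R) : R :=
  x ^+ 2 / 2 - pos_part t x ^+ 2 + pos_part u x ^+ 2.

Definition spline_d1 {R : realType} (t u x : R) : R :=
  x - 2 * pos_part t x + 2 * pos_part u x.

Definition spline_d2 {R : realType} (t u x : R) : R :=
  if (t < x) && (x < u) then -1 else 1.

Definition spline_prim {R : realType} (t u x : R) : R :=
  x ^+ 3 / 6 - pos_part t x ^+ 3 / 3 + pos_part u x ^+ 3 / 3.

(** The first-order Taylor remainder of a function whose second derivative takes the values 0 and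
    2. *)
Lemma pos_part_sqr (R : realType) (s x y : R) :
  0 <= pos_part s y ^+ 2 - pos_part s x ^+ 2 - 2 * pos_part s x * (y - x)
    <= (y - x) ^+ 2.
Proof.
have [ys|sy] := leP y s; have [xs|sx] := leP x s.
- rewrite !pos_part_le//; have := sqr_ge0 (y - x); lra.
- rewrite (pos_part_le ys) (pos_part_ge (ltW sx)); apply/andP; split.
    by have := mulr_ge0 (_ : 0 <= x - s) (_ : 0 <= s - y); have := sqr_ge0 (x - s); nra.
  have := sqr_ge0 (s - y); lra.
- rewrite (pos_part_le xs) (pos_part_ge (ltW sy)); have := sqr_ge0 (y - s).
  by have := mulr_ge0 (_ : 0 <= y - s) (_ : 0 <= s - x); have := sqr_ge0 (s - x); nra.
- rewrite (pos_part_ge (ltW sx)) (pos_part_ge (ltW sy)).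
  by have := sqr_ge0 (y - x); lra.
Qed.

Lemma pos_part_cube (R : realType) (s x y : R) : `|y - x| < 1 ->
  `|pos_part s y ^+ 3 - pos_part s x ^+ 3 - 3 * pos_part s x ^+ 2 * (y - x)|
    <= (3 * pos_part s x + 1) * (y - x) ^+ 2.
Proof.
rewrite ltr_norml => /andP[d1 d2].
have [ys|sy] := leP y s; have [xs|sx] := leP x s.
- rewrite !pos_part_le//.
  have -> : 0 ^+ 3 - 0 ^+ 3 - 3 * 0 ^+ 2 * (y - x) = 0 by ring.
  rewrite normr0; have := sqr_ge0 (y - x); lra.
- rewrite (pos_part_le ys) (pos_part_ge (ltW sx)).
  have -> : 0 ^+ 3 - (x - s) ^+ 3 - 3 * (x - s) ^+ 2 * (y - x) =
            (x - s) ^+ 2 * (3 * (x - y) - (x - s)) by ring.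
  rewrite ger0_norm; last by apply: mulr_ge0; [exact: sqr_ge0|lra].
  have q : (x - s) ^+ 2 <= (x - s) * (x - y) by nra.
  have q0 : 0 <= (y - x) ^+ 2 by exact: sqr_ge0.
  apply: (@le_trans _ _ ((x - s) ^+ 2 * (3 * (x - y)))).
    by apply: ler_wpM2l; [exact: sqr_ge0|lra].
  apply: (@le_trans _ _ ((x - s) * (x - y) * (3 * (x - y)))).
    by apply: ler_wpM2r; lra.
  have -> : (x - s) * (x - y) * (3 * (x - y)) = 3 * (x - s) * (y - x) ^+ 2 by ring.
  by lra.
- rewrite (pos_part_le xs) (pos_part_ge (ltW sy)).
  have -> : (y - s) ^+ 3 - 0 ^+ 3 - 3 * 0 ^+ 2 * (y - x) = (y - s) ^+ 3 by ring.
  rewrite ger0_norm ?exprn_ge0//; last lra.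
  have q : (y - s) ^+ 2 <= (y - x) ^+ 2 by nra.
  have q0 : 0 <= (y - s) ^+ 2 by exact: sqr_ge0.
  rewrite exprS; nra.
- rewrite !pos_part_ge ?(ltW sx) ?(ltW sy)//.
  have -> : (y - s) ^+ 3 - (x - s) ^+ 3 - 3 * (x - s) ^+ 2 * (y - x) =
            (3 * (x - s) + (y - x)) * (y - x) ^+ 2 by ring.
  rewrite normrM [X in _ * X <= _]ger0_norm ?sqr_ge0//.
  by apply: ler_wpM2r; [exact: sqr_ge0|rewrite ler_norml; lra].
Qed.

Lemma is_derive_spline (R : realType) (t u x : R) :
  is_derive x 1 (spline t u) (spline_d1 t u x).
Proof.
apply: (@quadratic_is_derive _ _ _ _ 1 2) => // y _.
have /andP[A1 A2] := pos_part_sqr t x y; have /andP[B1 B2] := pos_part_sqr u x y.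
by rewrite /spline /spline_d1 ler_norml; apply/andP; split; nra.
Qed.

Lemma is_derive_spline_prim (R : realType) (t u x : R) :
  is_derive x 1 (spline_prim t u) (spline t u x).
Proof.
apply: (@quadratic_is_derive _ _ _ _ 1
  (`|x| + 1 + (3 * pos_part t x + 1) + (3 * pos_part u x + 1))) => // y xy.
have := pos_part_cube t xy; have := pos_part_cube u xy; rewrite !ler_norml.
move=> /andP[A1 A2] /andP[B1 B2].
have /andP[C1 C2] : - ((`|x| + 1) * (y - x) ^+ 2)
   <= y ^+ 3 / 6 - x ^+ 3 / 6 - x ^+ 2 / 2 * (y - x)
   <= (`|x| + 1) * (y - x) ^+ 2.
  have -> : y ^+ 3 / 6 - x ^+ 3 / 6 - x ^+ 2 / 2 * (y - x) =
    (x / 2 + (y - x) / 6) * (y - x) ^+ 2.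
    by field.
  rewrite -ler_norml normrM [X in _ * X <= _]ger0_norm ?sqr_ge0//.
  apply: ler_wpM2r; first exact: sqr_ge0.
  have := ler_norm x; have := ler_norm (- x); rewrite normrN.
  by move: xy; rewrite ltr_norml ler_norml; lra.
have pt0 : 0 <= pos_part t x by rewrite /pos_part le_max lexx orbT.
have pu0 : 0 <= pos_part u x by rewrite /pos_part le_max lexx orbT.
have d0 : 0 <= (y - x) ^+ 2 by exact: sqr_ge0.
have := mulr_ge0 pt0 d0; have := mulr_ge0 pu0 d0; move=> D1 D2.
by rewrite /spline /spline_prim; apply/andP; split; lra.
Qed.

Lemma is_derive_spline_d1 (R : realType) (t u x : R) : t < u -> x != t -> x != u ->
  is_derive x 1 (spline_d1 t u) (spline_d2 t u x).
Proof.
move=> tu; rewrite -subr_eq0 -normr_gt0 => xt; rewrite -subr_eq0 -normr_gt0 => xu.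
(* Within this radius [y] stays on the same side of both breaks as [x], where [spline_d1] is affine
   and the remainder vanishes. *)
apply: (@quadratic_is_derive _ _ _ _ (Num.min `|x - t| `|x - u|) 0).
  by rewrite lt_min xt.
move=> y; rewrite mul0r lt_min => /andP[yt yu].
rewrite normr_le0 subr_eq0; apply/eqP; rewrite normr_gt0 subr_eq0 in xt.
rewrite normr_gt0 subr_eq0 in xu.
rewrite /spline_d1 /spline_d2.
have [xt'|tx|xt'] := ltgtP x t; last by rewrite xt' eqxx in xt.
  rewrite (ltr0_norm (_ : x - t < 0)) ?subr_lt0// ltr_norml in yt.
  rewrite !pos_part_le /=; lra.
rewrite (gtr0_norm (_ : 0 < x - t)) ?subr_gt0// ltr_norml in yt.
have [xu'|ux|xu'] := ltgtP x u; last by rewrite xu' eqxx in xu.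
  rewrite (ltr0_norm (_ : x - u < 0)) ?subr_lt0// ltr_norml in yu.
  have -> : pos_part u y = 0 by apply: pos_part_le; lra.
  have -> : pos_part u x = 0 by apply: pos_part_le; lra.
  by rewrite !pos_part_ge /=; lra.
rewrite (gtr0_norm (_ : 0 < x - u)) ?subr_gt0// ltr_norml in yu.
rewrite !pos_part_ge /=; lra.
Qed.

Lemma spline_d1_lipschitz (R : realType) (t u x y : R) : t < u -> x <= y ->
  `|spline_d1 t u y - spline_d1 t u x| <= y - x.
Proof.
move=> tu xy; rewrite ler_norml /spline_d1 /pos_part /Num.max.
by do !case: ifP; lra.
Qed.

Lemma derive_cc_spline (R : realType) (a b t u x : R) : a < b -> a <= x <= b ->
  derivable_cc a b (spline t u) x /\ derive_cc a b (spline t u) x = spline_d1 t u x.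
Proof.
by move=> ab xab; exact: derive_cc_is_derive ab xab (is_derive_spline t u x).
Qed.

Lemma derive2_cc_spline (R : realType) (a b t u x : R) : a < b -> t < u ->
  a <= x <= b -> x != t -> x != u ->
  derive_cc a b (derive_cc a b (spline t u)) x = spline_d2 t u x.
Proof.
move=> ab tu xab xt xu; apply: (slope_derivable_cc ab xab _).2 => e e0.
have [d d0 dP] := is_derive_slope (is_derive_spline_d1 tu xt xu) e0.
by exists d => // y yab yd; rewrite !(derive_cc_spline _ _ ab _).2//; exact: dP.
Qed.

(** A combination of indicators is visibly measurable. The values at the breaks, where [derive_cc]
    returns a default, are carried along as [h t] and [h u]. *)
Lemma spline_d2_restrictE (R : realType) (a b t u : R) : a < t -> t < u -> u < b ->
  let h := derive_cc a b (derive_cc a b (spline t u)) in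
  h \_ `[a, b]%classic =
  (fun x => h t * \1_[set t] x + h u * \1_[set u] x + \1_`[a, t[%classic x
            + (-1) * \1_`]t, u[%classic x + \1_`]u, b]%classic x) :> (R -> R).
Proof.
move=> at_ tu ub h; have ab : a < b by lra.
apply/funext => x; rewrite patchE !indicE !mem_setE !in_itv/=.
have -> : (x \in [set t]) = (x == t) by apply/idP/eqP; rewrite inE.
have -> : (x \in [set u]) = (x == u) by apply/idP/eqP; rewrite inE.
case: ifPn => [xab|/negP xab].
  have [->|xt] := eqVneq x t.
    by rewrite (lt_eqF tu) ltxx andbF/= (ltNge u t) (ltW tu)/=; ring.
  have [->|xu] := eqVneq x u.
    by rewrite ltxx andbF (ltNge u t) (ltW tu) andbF/=; ring.
  rewrite /h derive2_cc_spline// /spline_d2; move: xab xt xu => /andP[-> ->].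
  rewrite !andbT; case: ltgtP => // xt _; case: ltgtP => //= xu _; try ring.
  by exfalso; lra.
have -> : (x == t) = false by apply/eqP => xt; apply: xab; rewrite xt; lra.
have -> : (x == u) = false by apply/eqP => xt; apply: xab; rewrite xt; lra.
have -> : (a <= x < t) = false by apply/negP => xt; apply: xab; lra.
have -> : (t < x < u) = false by apply/negP => xt; apply: xab; lra.
have -> : (u < x <= b) = false by apply/negP => xt; apply: xab; lra.
by rewrite !mulr0 !addr0.
Qed.

Lemma spline_d2_measurable (R : realType) (a b t u : R) : a < t -> t < u -> u < b ->
  measurable_fun setT
    (derive_cc a b (derive_cc a b (spline t u)) \_ `[a, b]%classic).
Proof.
move=> at_ tu ub; rewrite spline_d2_restrictE//.
by repeat (apply: measurable_funD || apply: measurable_funM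
   || apply: measurable_cst || apply: measurable_indic) => //.
Qed.

Lemma Loo_norm_spline_le1 (R : realType) (a b t u : R) : a < b -> t < u ->
  (Loo_norm_cc a b (derive_cc a b (derive_cc a b (spline t u))) <= 1)%E.
Proof.
move=> ab tu; rewrite /Loo_norm_cc unlock.
have -> : (0 < @lebesgue_measure R setT)%E.
  by rewrite -set_itvNyy [ltRHS]lebesgue_measure_itv/= ltry.
apply/ess_sup_inf.ess_supP.
have N0 : (@lebesgue_measure R).-negligible ([set t] `|` [set u]).
  apply: negligibleU; [exists [set t]|exists [set u]]; split => //;
    exact: lebesgue_measure_set1.
apply: negligibleS N0 => x /= H; apply: contrapT => xtu; apply: H.
rewrite lee_fin patchE; case: ifPn => [|_]; last by rewrite normr0.
rewrite inE/= in_itv/= => xab; rewrite derive2_cc_spline//; first last.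
- by apply/eqP => xu; apply: xtu; right.
- by apply/eqP => xt; apply: xtu; left.
by rewrite /spline_d2; case: ifP; rewrite ?normrN normr1.
Qed.

Lemma spline_admissible (R : realType) (a b t u : R) : a < t -> t < u -> u < b ->
  admissible a b (spline t u).
Proof.
move=> at_ tu ub; have ab : a < b by lra.
split.
- by move=> x; rewrite in_itv/= => xab; exact: (derive_cc_spline t u ab xab).1.
(* [spline_d1] is 1-Lipschitz, so [e] itself serves as the length threshold. *)
- move=> e e0; exists e => // n x y xy _; apply: le_lt_trans.
  apply: ler_sum => i _; have [ax xi yb] := xy i.
  rewrite !(derive_cc_spline _ _ ab _).2 ?spline_d1_lipschitz//; lra.
- apply/andP; split; rewrite inE/=; first exact: spline_d2_measurable.
  rewrite /finite_norm -/(Loo_norm_cc a b _).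
  exact: le_lt_trans (Loo_norm_spline_le1 ab tu) (ltry _).
Qed.

Lemma spline_integral (R : realType) (a b t u : R) : a < b ->
  \int[@lebesgue_measure R]_(x in `[a, b]) spline t u x =
  spline_prim t u b - spline_prim t u a.
Proof.
move=> ab; have cF : continuous (spline_prim t u).
  move=> x; apply: differentiable_continuous; apply/derivable1_diffP.
  by case: (is_derive_spline_prim t u x).
have cf : continuous (spline t u).
  move=> x; apply: differentiable_continuous; apply/derivable1_diffP.
  by case: (is_derive_spline t u x).
rewrite /Rintegral (@continuous_FTC2 R (spline t u) (spline_prim t u) a b)//.
- by apply: continuous_subspaceT.
- split; first by move=> x _; case: (is_derive_spline_prim t u x).
    by apply: cvg_at_right_filter; exact: cF.
  by apply: cvg_at_left_filter; exact: cF.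
- by move=> x _; rewrite derive1E; case: (is_derive_spline_prim t u x).
Qed.

(** * Spline errors, the lower bound and uniqueness *)

(** [Psi] is a primitive of [psi]; the value is half the integral of [psi] with signs 1, -1, 1, that
    is, half of [(Psi t - Psi a) - (Psi u - Psi t) + (Psi b - Psi u)]. *)
Lemma quad_error_spline (R : realType) (a b t u : R) (psi : {poly R}) (p q : R) :
  a < t -> t < u -> u < b -> psi = 'X ^+ 2 + p *: 'X + q%:P ->
  let Psi x := x ^+ 3 / 3 + p * x ^+ 2 / 2 + q * x in
  quad_error a b psi (spline t u) = (Psi b - Psi a) / 2 + Psi t - Psi u.
Proof.
move=> at_ tu ub psiE Psi; have ab : a < b by lra.
rewrite /quad_error spline_integral//.
rewrite !(derive_cc_spline _ _ ab _).2 ?lexx ?ltW//.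
have E x : psi.[x] = x ^+ 2 + p * x + q by rewrite psiE !hornerE.
have dE x : psi^`().[x] = 2 * x + p.
  rewrite psiE !derivD derivC addr0 derivZ derivX derivXn.
  by rewrite !(hornerD, hornerMn, hornerZ, hornerX, hornerC)/=; ring.
rewrite !E !dE /spline_prim /spline /spline_d1 /Psi.
have -> : pos_part t a = 0 by apply: pos_part_le; lra.
have -> : pos_part u a = 0 by apply: pos_part_le; lra.
have -> : pos_part t b = b - t by apply: pos_part_ge; lra.
have -> : pos_part u b = b - u by apply: pos_part_ge; lra.
by field.
Qed.

Lemma monic_quadraticP (R : realType) (psi : {poly R}) : monic_quadratic psi ->
  psi = 'X ^+ 2 + psi`_1 *: 'X + (psi`_0)%:P.
Proof.
move=> [/monicP mpsi spsi]; rewrite lead_coefE spsi /= in mpsi.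
apply/polyP => i; rewrite !coefD coefXn coefZ coefX coefC.
case: i => [|[|[|i]]] /=; rewrite ?mulr0 ?mulr1 ?addr0 ?add0r//.
by rewrite nth_default// spsi.
Qed.

Lemma quadratic_monic (R : realType) (p q : R) :
  monic_quadratic ('X ^+ 2 + p *: 'X + q%:P).
Proof.
rewrite -addrA; have s2 : (size (p *: 'X + q%:P)%R < size ('X ^+ 2 : {poly R})%R)%N.
  rewrite size_polyXn ltnS (leq_trans (size_polyD _ _))// geq_max.
  rewrite (leq_trans (size_scale_leq _ _)) ?size_polyX//=.
  by rewrite (leq_trans (size_polyC_leq1 _)).
by split; [rewrite monicE lead_coefDl// lead_coefXn|rewrite size_polyDl// size_polyXn].
Qed.

Lemma centered_quadraticE (R : realType) (c al : R) :
  ('X - c%:P) ^+ 2 - (al ^+ 2)%:P =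
  'X ^+ 2 + (- (2 * c)) *: 'X + (c ^+ 2 - al ^+ 2)%:P :> {poly R}.
Proof.
have pE : (- (2 * c))%:P = - (2 * c%:P) :> {poly R}.
  by rewrite polyCN polyCM polyC_natr.
have qE : (c ^+ 2 - al ^+ 2)%:P = c%:P ^+ 2 - al%:P ^+ 2 :> {poly R}.
  by rewrite polyCB !polyC_exp.
by rewrite -mul_polyC pE qE polyC_exp; ring.
Qed.

Lemma Koo_ge_spline (R : realType) (a b t u : R) (psi : {poly R}) :
  a < t -> t < u -> u < b ->
  (`|quad_error a b psi (spline t u)|%:E <= Koo a b psi)%E.
Proof.
move=> at_ tu ub; apply: ereal_sup_ubound; exists (spline t u) => //.
by split; [exact: spline_admissible|apply: Loo_norm_spline_le1 => //; lra].
Qed.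

(** With these breaks the signs 1, -1, 1 are orthogonal to affine functions, so only the leading
    term of [psi] contributes. *)
Lemma quad_error_extremal (R : realType) (a b : R) (psi : {poly R}) : a < b ->
  monic_quadratic psi ->
  quad_error a b psi (spline ((a + b) / 2 - (b - a) / 4) ((a + b) / 2 + (b - a) / 4))
    = (b - a) ^+ 3 / 32.
Proof.
move=> ab /monic_quadraticP psiE.
rewrite (quad_error_spline _ _ _ psiE); [|lra..].
by field.
Qed.

Lemma Koo_phi1_le (R : realType) (a b : R) : a < b ->
  (Koo a b (('X - ((a + b) / 2)%:P) ^+ 2 - (((b - a) / 4) ^+ 2)%:P)
    <= ((b - a) ^+ 3 / 32)%:E)%E.
Proof.
move=> ab; apply: ge_ereal_sup => _ [f [fadm fN] <-].
have [M M0 NM] := Loo_cc_fin (let: And3 _ _ h := fadm in h).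
rewrite lee_fin (le_trans (quad_error_phi1_le ab fadm M0 NM))//.
rewrite ler_piMl//; last by rewrite NM lee_fin in fN.
by rewrite divr_ge0// exprn_ge0// subr_ge0 ltW.
Qed.

Lemma Koo_minimizer_unique (R : realType) (a b : R) (psi : {poly R}) : a < b ->
  monic_quadratic psi -> (Koo a b psi <= ((b - a) ^+ 3 / 32)%:E)%E ->
  psi = ('X - ((a + b) / 2)%:P) ^+ 2 - (((b - a) / 4) ^+ 2)%:P.
Proof.
move=> ab mpsi Kpsi; have psiE := monic_quadraticP mpsi.
set p := psi`_1 in psiE; set q := psi`_0 in psiE.
set c := (a + b) / 2; set al := (b - a) / 4.
pose Psi : {poly R} := (1 / 3) *: 'X ^+ 3 + (p / 2) *: 'X ^+ 2 + q *: 'X.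
have PsiE x : Psi.[x] = x ^+ 3 / 3 + p * x ^+ 2 / 2 + q * x.
  by rewrite /Psi !(hornerD, hornerZ, hornerX, hornerXn); field.
have dPsiE x : Psi^`().[x] = x ^+ 2 + p * x + q.
  rewrite /Psi !derivD !derivZ !derivXn derivX.
  by rewrite !(hornerD, hornerMn, hornerZ, hornerX, hornerC, horner_exp)/=; field.
have ub t u : a < t -> t < u -> u < b ->
    (Psi.[b] - Psi.[a]) / 2 + Psi.[t] - Psi.[u] <= (b - a) ^+ 3 / 32.
  move=> at_ tu ub; have := le_trans (Koo_ge_spline psi at_ tu ub) Kpsi.
  rewrite lee_fin (quad_error_spline at_ tu ub psiE) -!PsiE.
  exact: (le_trans (ler_norm _)).
have eq0 : (Psi.[b] - Psi.[a]) / 2 + Psi.[c - al] - Psi.[c + al] = (b - a) ^+ 3 / 32.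
  rewrite -(quad_error_extremal ab mpsi) (quad_error_spline _ _ _ psiE) -?PsiE//; lra.
(* With the second break fixed at [c + al], [Psi] is maximal at [c - al] among first breaks in []a,
   c + al[], so its derivative [psi] vanishes there. *)
have r1 : (c - al) ^+ 2 + p * (c - al) + q = 0.
  rewrite -dPsiE; have H : is_derive (c - al) 1 (horner Psi) 0.
    apply: (@derive1_at_max R (horner Psi) a (c + al)).
    - by rewrite /c /al; lra.
    - by move=> t _; exact: derivable_horner.
    - by rewrite in_itv/= /c /al; lra.
    - move=> t; rewrite in_itv/= => /andP[at_ tc].
      have : c + al < b by rewrite /c /al; lra.
      by move=> /(ub _ _ at_ tc); rewrite -eq0; lra.
  rewrite -(@derive_val _ _ _ _ _ _ _ H).
  by rewrite (@derive_val _ _ _ _ _ _ _ (is_derive_poly Psi _)).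
(* The second break enters with a minus sign, so [c + al] is a minimum of [Psi]. *)
have r2 : (c + al) ^+ 2 + p * (c + al) + q = 0.
  rewrite -dPsiE; have H : is_derive (c + al) 1 (horner Psi) 0.
    apply: (@derive1_at_min R (horner Psi) (c - al) b).
    - by rewrite /c /al; lra.
    - by move=> t _; exact: derivable_horner.
    - by rewrite in_itv/= /c /al; lra.
    - move=> t; rewrite in_itv/= => /andP[ct tb].
      have ac : a < c - al by rewrite /c /al; lra.
      by have := ub _ _ ac ct tb; rewrite -eq0; lra.
  rewrite -(@derive_val _ _ _ _ _ _ _ H).
  by rewrite (@derive_val _ _ _ _ _ _ _ (is_derive_poly Psi _)).
have al0 : al != 0 by rewrite /al; apply/eqP; lra.
have pE : p = - (2 * c).
  apply: (mulfI al0).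
  have : ((c + al) ^+ 2 + p * (c + al) + q)
    - ((c - al) ^+ 2 + p * (c - al) + q) = 0.
    by rewrite r1 r2 subrr.
  lra.
have qE : q = c ^+ 2 - al ^+ 2 by move: r1; rewrite pE; lra.
by rewrite centered_quadraticE psiE pE qE.
Qed.

Unset Implicit Arguments.

Theorem corollary2p4 (R : realType) (a b : R) (hab : a < b) :
  let c := (a + b) / 2 in
  let alpha1 := (b - a) / 4 in
  let phi1 : {poly R} := ('X - c%:P) ^+ 2 - (alpha1 ^+ 2)%:P in
  [/\ [set phi | monic_quadratic phi /\
         forall psi, monic_quadratic psi -> (Koo a b phi <= Koo a b psi)%E]
        = [set phi1],
      forall f, admissible a b f ->
        \int[@lebesgue_measure R]_(x in `[a, b]) f x
          = (b - a) / 2 * (f a + f b)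
            + 3 * (b - a) ^+ 2 / 32 * (derive_cc a b f a - derive_cc a b f b)
            + quad_error a b phi1 f,
      forall f, admissible a b f ->
        (`|quad_error a b phi1 f|%:E <=
           Loo_norm_cc a b (derive_cc a b (derive_cc a b f))
             * ((b - a) ^+ 3 / 32)%:E)%E
    & forall C : R,
        (forall f, admissible a b f ->
          (`|quad_error a b phi1 f|%:E <=
             Loo_norm_cc a b (derive_cc a b (derive_cc a b f)) * C%:E)%E) ->
        (b - a) ^+ 3 / 32 <= C].
Proof.
move=> c alpha1 phi1.
have mphi1 : monic_quadratic phi1.
  by rewrite /phi1 centered_quadraticE; exact: quadratic_monic.
have K0 : 0 < (b - a) ^+ 3 / 32 by rewrite divr_gt0// exprn_gt0// subr_gt0.
have at_ : a < c - alpha1 by rewrite /c /alpha1; lra.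
have tu : c - alpha1 < c + alpha1 by rewrite /alpha1; lra.
have ub : c + alpha1 < b by rewrite /c /alpha1; lra.
have Kge psi : monic_quadratic psi -> (((b - a) ^+ 3 / 32)%:E <= Koo a b psi)%E.
  move=> mpsi; have := Koo_ge_spline psi at_ tu ub.
  by rewrite (quad_error_extremal hab mpsi) (gtr0_norm K0).
split.
- apply/seteqP; split => [psi [mpsi psimin]|_ ->] /=.
    apply: (Koo_minimizer_unique hab mpsi).
    exact: le_trans (psimin _ mphi1) (Koo_phi1_le hab).
  by split => // psi /Kge; apply: le_trans; exact: Koo_phi1_le.
- by move=> f _; rewrite quad_error_phi1; ring.
- move=> f fadm; have [M M0 NM] := Loo_cc_fin (let: And3 _ _ h := fadm in h).
  by rewrite NM -EFinM lee_fin; exact: quad_error_phi1_le.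
(* The extremal spline has error [(b - a) ^+ 3 / 32] and norm [M] with [0 <= M <= 1], so this
   constant is at most [M * C]; as it is positive, [C] cannot be negative. *)
- move=> C HC; have fadm := spline_admissible at_ tu ub.
  have [M M0 NM] := Loo_cc_fin (let: And3 _ _ h := fadm in h).
  have := HC _ fadm; rewrite (quad_error_extremal hab mphi1) (gtr0_norm K0).
  rewrite NM -EFinM lee_fin => KMC.
  have M1 : M <= 1 by rewrite -lee_fin -NM; exact: Loo_norm_spline_le1.
  have [C0|C0] := leP 0 C; first by rewrite (le_trans KMC)// ler_piMl.
  by have := mulr_ge0_le0 M0 (ltW C0); lra.
Qed.
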